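(* Let $\ell_p^*=\frac{n-p}{p-1}$. Assume that there are constants $A,B>0$, $\ell$ with $\ell_p^*<\ell\le\frac{n}{p-1}$, and a function $h$ such that $\mathcal{K}(r)=A+Br^{\ell}+h(r)$ and $\lim_{r\to 0}\frac{|h(r)|+r|h'(r)|}{r^{\ell}}=0$. Assume further that at least one of the following holds: (a) the function $t\mapsto\mathcal{K}(e^t)$ is uniformly continuous in $[0,+\infty)$ and there are $\overline{K}>\underline{K}>0$ such that $\underline{K}<\mathcal{K}(r)<\overline{K}$ for any $r>0$; (b) there is $\rho_1>0$ such that $\mathcal{K}(r)\ge\mathcal{K}(\rho_1)$ when $r\ge\rho_1$. Then $\lim_{d\to+\infty}R(d)=+\infty$.
   Context: Standing assumptions: $n$ is a positive integer, $p$ is real with $1<p<n$ and $\frac{2n}{n+2}\le p\le 2$, $q=\frac{np}{n-p}$, and $\mathcal{K}:[0,+\infty)\to(0,+\infty)$ is $C^1$. For each $d>0$, $u(r;d)$ denotes the unique (regular) solution of $(r^{n-1}u'|u'|^{p-2})'+r^{n-1}\mathcal{K}(r)u|u|^{q-2}=0$ with $\lim_{r\to0}u(r;d)=d$ (it satisfies $u'(0;d)=0$). $J$ is the set of $d>0$ such that $u(\cdot;d)$ is a crossing solution, i.e. has a zero at some finite positive $r$, and for $d\in J$, $R(d)>0$ denotes the first zero of $u(\cdot;d)$. (Under the stated hypotheses $J$ contains a half-line $(\hat D,+\infty)$, so the limit makes sense.) *)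

(* Defs.v *)
From Stdlib Require Import Reals.
From Coquelicot Require Import Coquelicot.
Open Scope R_scope.

Definition critical_exponent (n : nat) (p : R) : R := INR n * p / (INR n - p).

(* [signed_power m x] is x |x|^(m-2).  At x = 0 it is 0 for every m, also when
   m < 2: Stdlib has [ln 0 = 0], so [Rpower 0 (m - 2) = 1]. *)
Definition signed_power (m x : R) : R := x * Rpower (Rabs x) (m - 2).

(* K is of class C^1 on the closed half-line [0,+oo), with one-sided
   derivative at 0, and takes positive values there; the values of K at
   negative arguments play no role. *)
Definition positive_C1_half_line (K : R -> R) : Prop :=
  (forall r, 0 <= r -> 0 < K r) /\
  exists K' : R -> R,
    forall r, 0 <= r ->
      D_in K K' (fun s => 0 <= s) r /\ continue_in K' (fun s => 0 <= s) r.

(* w is the regular solution with initial value d.  The equation is required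
   on (0,+oo); w'(0) = 0 is a consequence of the finite limit at 0 and is not
   part of the definition, and the value [w 0] is irrelevant. *)
Definition regular_solution (n : nat) (p : R) (K : R -> R) (d : R)
    (w : R -> R) : Prop :=
  (forall r, 0 < r ->
     ex_derive w r /\
     is_derive (fun s => s ^ (n - 1) * signed_power p (Derive w s)) r
       (- (r ^ (n - 1) * K r * signed_power (critical_exponent n p) (w r)))) /\
  filterlim w (at_right 0) (locally d).

Definition crossing_set (u : R -> R -> R) (d : R) : Prop :=
  0 < d /\ exists r, 0 < r /\ u d r = 0.

Definition is_first_zero (w : R -> R) (rho : R) : Prop :=
  0 < rho /\ w rho = 0 /\ forall r, 0 < r < rho -> w r <> 0.

(* Main.v *)
Require Import Defs.
From Stdlib Require Import Reals Lra Classical Ranalysis5.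
From Coquelicot Require Import Coquelicot.
Open Scope R_scope.

(* Put alpha = (n-p)/p, m = (n-p)/(p-1) and lambda = d^(1/alpha).  By scale
   invariance v(s) = u(s/lambda)/d solves the same equation with coefficient
   K(s/lambda) and v(0) = 1; its flux is W = s^(n-1) |v'|^(p-1), which increases
   as long as v > 0.  Since K' > 0 near 0, the Pohozaev functional is nonnegative
   there, so v lies below a bubble: v <= C s^(-m).  As m < l, integrating K' s^n v^q
   then bounds the functional by o(lambda^(-m)).  Its kinetic part
   ((p-1)/p) W (s |v'| - m v) controls the derivative of s^m v, and the bound keeps
   s^m v away from 0 up to s = lambda M; hence R(d) > M.
   For the existence of a zero: with v >= c s^(-m), the assumption l <= n/(p-1)
   makes the functional at a fixed radius at least c lambda^(-n/(p-1)) log(lambda),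
   whereas its potential part there is O(lambda^(-n/(p-1))).  So its kinetic part is
   eventually positive, i.e. s |v'| > m v at some point, and as W increases this
   forces v to vanish. *)

(** The sign and the size of K' are known only on an interval (0,rho), whereas M is arbitrary. The
    Pohozaev identity is therefore used only up to s = lambda rho / 2. From there to lambda M only
    an upper bound of K is available, and the kinetic part is shown to grow by at most a constant
    times lambda^N v(lambda rho / 2)^q = O(lambda^(-N/(p-1))), which is again o(lambda^(-m)).
    Turning a small kinetic part into a lower bound for s^m v requires a lower bound for W. It comes
    from an initial stretch where v >= 1/2, whose length does not depend on lambda. The equation is
    singular at 0 and only limits are known there, so an integration from 0 is replaced by the
    monotonicity of an explicit comparison function together with its behaviour at 0. *)

Lemma Rpower_pos (x a : R) : 0 < Rpower x a.
Proof. apply exp_pos. Qed.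

Lemma Rpower_pred (x a : R) : 0 < x -> Rpower x a = x * Rpower x (a - 1).
Proof.
  intros hx. rewrite <- (Rpower_1 x) at 2 by exact hx.
  rewrite <- Rpower_plus. f_equal. ring.
Qed.

Lemma Rpower_base_1 (a : R) : Rpower 1 a = 1.
Proof. unfold Rpower. rewrite ln_1, Rmult_0_r. apply exp_0. Qed.

Lemma Rpower_neg_le (x y a : R) : a <= 0 -> 0 < x <= y -> Rpower y a <= Rpower x a.
Proof.
  intros ha [hx hxy].
  replace a with (- - a) by ring. rewrite !(Rpower_Ropp _ (- a)).
  apply Rinv_le_contravar; [apply Rpower_pos|].
  apply Rle_Rpower_l; lra.
Qed.

Lemma Rpower_le_1 (x a : R) : 0 <= a -> 0 < x <= 1 -> Rpower x a <= 1.
Proof.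
  intros ha hx. pose proof (Rle_Rpower_l x 1 a ha hx) as h.
  now rewrite Rpower_base_1 in h.
Qed.

Lemma Rpower_ge_1 (x a : R) : a <= 0 -> 0 < x <= 1 -> 1 <= Rpower x a.
Proof.
  intros ha hx. pose proof (Rpower_neg_le x 1 a ha hx) as h.
  now rewrite Rpower_base_1 in h.
Qed.

Lemma Rpower_le_self (x a : R) : 1 <= a -> 0 < x <= 1 -> Rpower x a <= x.
Proof.
  intros ha hx. rewrite Rpower_pred by lra.
  assert (Rpower x (a - 1) <= Rpower 1 (a - 1)) by (apply Rle_Rpower_l; lra).
  rewrite Rpower_base_1 in H. pose proof (Rpower_pos x (a - 1)). nra.
Qed.

Lemma Rpower_small_at_infinity (a c : R) :
  a < 0 -> 0 < c -> exists X, forall x, X < x -> Rpower x a < c.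
Proof.
  intros ha hc. exists (Rpower c (/ a)). intros x hx.
  pose proof (Rpower_pos c (/ a)).
  assert (h : Rpower (Rpower c (/ a)) (- a) < Rpower x (- a))
    by (apply Rlt_Rpower_l; lra).
  rewrite Rpower_mult in h.
  replace (/ a * - a) with (- (1)) in h by (field; lra).
  rewrite !Rpower_Ropp, Rpower_1 in h by lra.
  apply Rinv_lt_cancel; [exact hc|]. exact h.
Qed.

Ltac pos := repeat first
  [ assumption | apply Rpower_pos | apply Rmult_lt_0_compat
  | apply Rdiv_lt_0_compat | apply Rinv_0_lt_compat | lra ].

(* Identities between products of powers of positive reals, by comparing logarithms. *)
Ltac rpower := apply ln_inv; [pos | pos |];
  repeat first [rewrite ln_mult by pos | rewrite ln_div by pos
               | rewrite ln_Rpower | rewrite ln_Rinv by pos];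
  try (field; repeat split; lra).

(** * Computing derivatives and comparing functions through them *)

Lemma is_derive_R_eq (f : R -> R) (x l l' : R) :
  is_derive f x l -> l = l' -> is_derive f x l'.
Proof. intros h <-. exact h. Qed.

Lemma is_derive_R_plus (f g : R -> R) (x a b : R) :
  is_derive f x a -> is_derive g x b -> is_derive (fun t => f t + g t) x (a + b).
Proof. intros hf hg. exact (is_derive_plus f g x a b hf hg). Qed.

Lemma is_derive_R_minus (f g : R -> R) (x a b : R) :
  is_derive f x a -> is_derive g x b -> is_derive (fun t => f t - g t) x (a - b).
Proof. intros hf hg. exact (is_derive_minus f g x a b hf hg). Qed.

Lemma is_derive_R_mult (f g : R -> R) (x a b : R) :
  is_derive f x a -> is_derive g x b ->
  is_derive (fun t => f t * g t) x (a * g x + f x * b).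
Proof. intros hf hg. exact (is_derive_mult f g x a b hf hg Rmult_comm). Qed.

Lemma is_derive_R_power (f : R -> R) (x a b : R) :
  0 < f x -> is_derive f x a ->
  is_derive (fun t => Rpower (f t) b) x (b * Rpower (f x) b / f x * a).
Proof.
  intros hf h.
  eapply is_derive_R_eq.
  - apply (is_derive_comp (fun y => Rpower y b) f x).
    + apply is_derive_Reals. apply derivable_pt_lim_power. exact hf.
    + exact h.
  - unfold scal; simpl; unfold mult; simpl.
    rewrite (Rpower_pred (f x) b hf). field. lra.
Qed.

(** The value of the derivative is left as an existential variable, which the rules fill in from the
    syntax of the function. Derivatives of unknown functions are taken from the context; positivity
    of the bases of powers is left to the caller. *)
Ltac derive_rules := cbv beta; lazymatch goal with
  | |- is_derive (fun _ => ?c) _ _ =>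
      apply (is_derive_const (K := R_AbsRing) (V := R_NormedModule) c)
  | |- is_derive (fun t => t) _ _ => apply (is_derive_id (K := R_AbsRing))
  | |- is_derive (fun t => @?f t + @?g t) _ _ =>
      eapply (is_derive_R_plus f g); derive_rules
  | |- is_derive (fun t => @?f t - @?g t) _ _ =>
      eapply (is_derive_R_minus f g); derive_rules
  | |- is_derive (fun t => @?f t * @?g t) _ _ =>
      eapply (is_derive_R_mult f g); derive_rules
  | |- is_derive (fun t => Rpower (@?f t) ?b) _ _ =>
      eapply (is_derive_R_power f _ _ b); [| derive_rules]
  | |- is_derive _ _ _ => eassumption
  end.

Lemma nondecreasing_of_derive (f : R -> R) (x y : R) :
  x <= y -> (forall t, x <= t <= y -> exists l, is_derive f t l /\ 0 <= l) ->
  f x <= f y.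
Proof.
  intros hxy h.
  assert (hD : forall t, x <= t <= y -> is_derive f t (Derive f t) /\ 0 <= Derive f t).
  { intros t ht. destruct (h t ht) as [l [hl hl0]].
    rewrite (is_derive_unique _ _ _ hl). now split. }
  destruct (MVT_gen f x y (Derive f)) as [c [hc he]].
  - rewrite Rmin_left, Rmax_right by lra. intros t ht. apply hD. lra.
  - rewrite Rmin_left, Rmax_right by lra. intros t ht.
    apply continuity_pt_filterlim. apply (ex_derive_continuous (V := R_NormedModule)).
    exists (Derive f t). apply hD. lra.
  - rewrite Rmin_left, Rmax_right in hc by lra.
    destruct (hD c) as [_ h0]; [lra|]. nra.
Qed.

(** This is the substitute for integrating from 0: [f] need not be continuous at 0, and [c] only has
    to be an asymptotic lower bound there. *)
Lemma ge_of_nondecreasing (f : R -> R) (b c x : R) :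
  (forall t, 0 < t < b -> exists l, is_derive f t l /\ 0 <= l) ->
  (forall eps, 0 < eps ->
     exists delta, 0 < delta /\ forall t, 0 < t < delta -> c - eps <= f t) ->
  0 < x < b -> c <= f x.
Proof.
  intros h h0 hx. apply le_epsilon. intros eps heps.
  destruct (h0 eps heps) as [delta [hdelta hf]].
  set (t := Rmin x (delta / 2)).
  assert (0 < t) by (apply Rmin_glb_lt; lra).
  assert (t <= x) by apply Rmin_l.
  assert (t <= delta / 2) by apply Rmin_r.
  specialize (hf t ltac:(lra)).
  assert (f t <= f x).
  { apply (nondecreasing_of_derive f); [lra|]. intros z hz. apply h. lra. }
  lra.
Qed.

(** * Positive solutions in rescaled variables *)

(* After the rescaling v(s) = u(s/lambda)/d, the equation in flux form:
   W = s^(N-1) |v'|^(p-1) and hence -v' = (W s^(1-N))^(1/(p-1)). *)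
Definition speed (N p s W : R) : R := Rpower (W * Rpower s (1 - N)) (/ (p - 1)).

(** Positivity of [v] and [W] is built in because [Rpower] represents a power on positive bases
    only. Regularity at the centre is the condition that [W] tends to 0; given its sign, an upper
    bound expresses this. *)
Definition regular_flow (N p : R) (k v W : R -> R) (T : R) : Prop :=
  (forall s, 0 < s < T ->
     0 < v s /\ 0 < W s /\
     is_derive v s (- speed N p s (W s)) /\
     is_derive W s (Rpower s (N - 1) * k s * Rpower (v s) (N * p / (N - p) - 1))) /\
  (forall eps, 0 < eps -> exists delta, 0 < delta /\
     forall s, 0 < s < delta -> Rabs (v s - 1) < eps /\ W s < eps).

(* The Pohozaev functional without its potential term; its sign is that of
   the derivative of -s^((N-p)/(p-1)) v(s). *)
Definition kinetic_defect (N p : R) (v W : R -> R) (s : R) : R :=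
  (p - 1) / p * W s * (s * speed N p s (W s) - (N - p) / (p - 1) * v s).

(** With w = |v'| and W = s^(N-1) w^(p-1) this is the usual s^N ((p-1)/p w^p + k v^q / q) -
    ((N-p)/p) s^(N-1) v w^(p-1); the coefficient (N-p)/(N p) is 1/q. *)
Definition pohozaev (N p : R) (k v W : R -> R) (s : R) : R :=
  kinetic_defect N p v W s
  + (N - p) / (N * p) * (k s * Rpower s N * Rpower (v s) (N * p / (N - p))).

Section Flow.

Context (N p : R) (hp : 1 < p < N).

Local Notation q := (N * p / (N - p)).
Local Notation m := ((N - p) / (p - 1)).
Local Notation e := (/ (p - 1)).

Lemma inv_sub_1_pos : 0 < e. Proof. pos. Qed.
Lemma decay_exponent_pos : 0 < m. Proof. pos. Qed.
Lemma critical_exponent_gt_1 : 1 < q.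
Proof.
  apply (Rmult_lt_reg_r (N - p)); [lra|].
  replace (q * (N - p)) with (N * p) by (field; lra). nra.
Qed.

Lemma is_derive_speed (W : R -> R) (s W' : R) :
  0 < s -> 0 < W s -> is_derive W s W' ->
  is_derive (fun t => speed N p t (W t)) s
    (speed N p s (W s) * e * (W' / W s - (N - 1) / s)).
Proof.
  intros hs hW h. unfold speed.
  eapply is_derive_R_eq.
  - derive_rules; pos.
  - change one with 1.
    pose proof (Rpower_pos s (1 - N)).
    set (X := Rpower (W s * _) _). set (Y := Rpower s _) in *.
    field. repeat split; lra.
Qed.

Context (k v W : R -> R) (T : R).
Context (hflow : regular_flow N p k v W T).

(** The terms without W' cancel because 1 + m = (N-1)/(p-1), and what remains is W' times a
    bracket. *)
Lemma is_derive_kinetic_defect (s : R) : 0 < s < T ->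
  is_derive (kinetic_defect N p v W) s
    (Rpower s (N - 1) * k s * Rpower (v s) (q - 1)
     * (s * speed N p s (W s) - (N - p) / p * v s)).
Proof.
  intros hs. destruct (proj1 hflow s hs) as [hv [hW [dv dW]]].
  pose proof (is_derive_speed W s _ (proj1 hs) hW dW) as dspeed.
  unfold kinetic_defect. eapply is_derive_R_eq; [derive_rules|].
  change one with 1. change zero with 0.
  set (w := speed _ _ _ _). set (X := Rpower s _). set (Y := Rpower (v s) _).
  field. repeat split; lra.
Qed.

(** Here q is critical: N/q = (N-p)/p, so the derivatives of s^N and of v^q cancel the derivative of
    the kinetic part. *)
Lemma is_derive_pohozaev (s k' : R) : 0 < s < T -> is_derive k s k' ->
  is_derive (pohozaev N p k v W) s
    ((N - p) / (N * p) * (k' * Rpower s N * Rpower (v s) q)).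
Proof.
  intros hs dk. pose proof (is_derive_kinetic_defect s hs) as dkin.
  destruct (proj1 hflow s hs) as [hv [hW [dv dW]]].
  unfold pohozaev. eapply is_derive_R_eq; [derive_rules; lra|].
  change one with 1. change zero with 0.
  rewrite (Rpower_pred s N), (Rpower_pred (v s) q) by lra.
  set (w := speed _ _ _ _). set (X := Rpower s _). set (Y := Rpower (v s) _).
  field. repeat split; lra.
Qed.

Lemma flux_nondecreasing (x y : R) :
  (forall s, 0 < s < T -> 0 < k s) ->
  0 < x -> x <= y -> y < T -> W x <= W y.
Proof.
  intros hk hx hxy hy. apply (nondecreasing_of_derive W); [exact hxy|]. intros t ht.
  destruct (proj1 hflow t ltac:(lra)) as [hv [hW [dv dW]]].
  eexists; split; [exact dW|].
  specialize (hk t ltac:(lra)). apply Rlt_le. pos.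
Qed.

Lemma flow_le_1 (s : R) : 0 < s < T -> v s <= 1.
Proof.
  intros hs. enough (- (1) <= - v s) by lra.
  apply (ge_of_nondecreasing (fun t => - v t) T); trivial.
  - intros t ht. destruct (proj1 hflow t ht) as [hv [hW [dv dW]]].
    exists (- - speed N p t (W t)). split.
    + exact (is_derive_opp v t _ dv).
    + pose proof (Rpower_pos (W t * Rpower t (1 - N)) e). unfold speed. lra.
  - intros eps heps. destruct (proj2 hflow eps heps) as [delta [hd h]].
    exists delta. split; trivial. intros t ht.
    destruct (h t ht) as [h1 _]. apply Rabs_def2 in h1. lra.
Qed.

(** The solution is positive up to [T], while the coefficient is controlled up to [S]; after
    rescaling, S = lambda rho. *)
Context (k1 k2 S : R) (hk1 : 0 < k1).
Context (hk : forall s, 0 < s < S -> k1 <= k s <= k2).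
Context (hS : 0 < S).

Lemma coefficient_upper_pos : 0 < k2.
Proof. specialize (hk (S / 2) ltac:(lra)). lra. Qed.

Lemma flux_le (s : R) : 0 < s < Rmin T S -> W s <= k2 / N * Rpower s N.
Proof.
  intros hs.
  assert (hmin : forall t, t < Rmin T S -> t < T /\ t < S)
    by (intros t ht; split; eapply Rlt_le_trans; eauto; [apply Rmin_l|apply Rmin_r]).
  enough (0 <= k2 / N * Rpower s N - W s) by lra.
  apply (ge_of_nondecreasing (fun t => k2 / N * Rpower t N - W t) (Rmin T S)); trivial.
  - intros t ht. destruct (hmin t (proj2 ht)) as [htT htS].
    destruct (proj1 hflow t ltac:(lra)) as [hv [hW [dv dW]]].
    eexists. split; [derive_rules; lra|].
    change one with 1. change zero with 0.
    rewrite (Rpower_pred t N) by lra.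
    replace (_ - _) with
      (Rpower t (N - 1) * (k2 - k t * Rpower (v t) (q - 1))) by (field; lra).
    pose proof (flow_le_1 t ltac:(lra)) as hv1.
    assert (hv2 : Rpower (v t) (q - 1) <= 1)
      by (apply Rpower_le_1; pose proof critical_exponent_gt_1; lra).
    pose proof (Rpower_pos (v t) (q - 1)).
    specialize (hk t ltac:(lra)).
    apply Rmult_le_pos; [apply Rlt_le; pos | nra].
  - intros eps heps. destruct (proj2 hflow eps heps) as [delta [hd h]].
    exists delta. split; trivial. intros t ht.
    destruct (h t ht) as [_ h1]. pose proof (Rpower_pos t N). pose proof coefficient_upper_pos.
    assert (0 < k2 / N * Rpower t N) by pos. lra.
Qed.

Lemma speed_le (s : R) : 0 < s < Rmin T S ->
  speed N p s (W s) <= Rpower (k2 / N) e * Rpower s e.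
Proof.
  intros hs. pose proof coefficient_upper_pos.
  assert (hT : s < T) by (eapply Rlt_le_trans; [apply hs|apply Rmin_l]).
  destruct (proj1 hflow s ltac:(lra)) as [hv [hW _]].
  rewrite Rpower_mult_distr by pos. unfold speed.
  apply Rle_Rpower_l; [pose proof inv_sub_1_pos; lra|]. split; [pos|].
  apply (Rle_trans _ (k2 / N * Rpower s N * Rpower s (1 - N))).
  - apply Rmult_le_compat_r; [apply Rlt_le; pos | now apply flux_le].
  - rewrite Rmult_assoc, <- Rpower_plus.
    replace (N + (1 - N)) with 1 by ring. rewrite Rpower_1 by lra. lra.
Qed.

(** Integrating [speed_le] gives 1 - v <= (k2/N)^(1/(p-1)) ((p-1)/p) s^(p/(p-1)). The right-hand
    side equals 1/2 at this s, which depends on [N], [p] and [k2] only and hence serves all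
    rescalings. *)
Definition half_life : R :=
  Rpower (p / (p - 1) / 2 / Rpower (k2 / N) e) ((p - 1) / p).

Lemma half_life_pos : 0 < half_life.
Proof. apply Rpower_pos. Qed.

Lemma flow_ge_half (s : R) :
  0 < s < Rmin T S -> s <= half_life -> / 2 <= v s.
Proof.
  intros hs hs1. pose proof coefficient_upper_pos as hk2.
  set (c := Rpower (k2 / N) e * ((p - 1) / p)).
  assert (hc : 0 < c) by (unfold c; pos).
  assert (h : 1 <= v s + c * Rpower s (p / (p - 1))).
  { apply (ge_of_nondecreasing (fun t => v t + c * Rpower t (p / (p - 1))) (Rmin T S)); trivial.
    - intros t ht.
      assert (htT : t < T) by (eapply Rlt_le_trans; [apply ht|apply Rmin_l]).
      destruct (proj1 hflow t ltac:(lra)) as [hv [hW [dv dW]]].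
      eexists. split; [derive_rules; lra|].
      change one with 1. change zero with 0.
      rewrite (Rpower_pred t (p / (p - 1))) by lra.
      replace (p / (p - 1) - 1) with e by (field; lra).
      pose proof (speed_le t ht) as h. unfold c.
      match goal with |- 0 <= ?x =>
        replace x with (Rpower (k2 / N) e * Rpower t e - speed N p t (W t))
          by (field; repeat split; lra) end.
      lra.
    - intros eps heps. destruct (proj2 hflow eps heps) as [delta [hd h]].
      exists delta. split; trivial. intros t ht.
      destruct (h t ht) as [h1 _]. apply Rabs_def2 in h1.
      assert (0 < c * Rpower t (p / (p - 1))) by pos. lra. }
  assert (h2 : Rpower s (p / (p - 1)) <= Rpower half_life (p / (p - 1)))
    by (apply Rle_Rpower_l; [apply Rlt_le; pos | lra]).
  unfold half_life in h2. rewrite Rpower_mult in h2.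
  replace ((p - 1) / p * (p / (p - 1))) with 1 in h2 by (field; lra).
  rewrite Rpower_1 in h2 by pos.
  assert (h3 : c * Rpower s (p / (p - 1)) <= c * (p / (p - 1) / 2 / Rpower (k2 / N) e))
    by (apply Rmult_le_compat_l; lra).
  replace (c * (p / (p - 1) / 2 / Rpower (k2 / N) e)) with (/ 2) in h3.
  - lra.
  - unfold c. pose proof (Rpower_pos (k2 / N) e). field. repeat split; lra.
Qed.

(** While v >= 1/2, the derivative of W is at least k1 (1/2)^(q-1) s^(N-1), whose integral is this
    constant times s^N. *)
Definition initial_flux : R := k1 * Rpower (/ 2) (q - 1) / N.

Lemma initial_flux_pos : 0 < initial_flux.
Proof. unfold initial_flux. pos. Qed.

Lemma flux_ge (s : R) :
  0 < s < Rmin T S -> s < half_life -> initial_flux * Rpower s N <= W s.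
Proof.
  intros hs hs1.
  set (b := Rmin (Rmin T S) half_life).
  assert (hb : forall t, t < b -> t < Rmin T S /\ t < T /\ t < S /\ t < half_life).
  { intros t ht. unfold b in ht.
    pose proof (Rmin_l (Rmin T S) half_life). pose proof (Rmin_r (Rmin T S) half_life).
    pose proof (Rmin_l T S). pose proof (Rmin_r T S). repeat split; lra. }
  enough (0 <= W s - initial_flux * Rpower s N) by lra.
  apply (ge_of_nondecreasing (fun t => W t - initial_flux * Rpower t N) b).
  - intros t ht. destruct (hb t (proj2 ht)) as [h0 [h1 [h2 h3]]].
    destruct (proj1 hflow t ltac:(lra)) as [hv [hW [dv dW]]].
    eexists. split; [derive_rules; lra|].
    change one with 1. change zero with 0.
    rewrite (Rpower_pred t N) by lra.
    match goal with |- 0 <= ?x => replace x with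
      (Rpower t (N - 1) * (k t * Rpower (v t) (q - 1) - k1 * Rpower (/ 2) (q - 1)))
      by (unfold initial_flux; field; lra) end.
    assert (Rpower (/ 2) (q - 1) <= Rpower (v t) (q - 1)).
    { apply Rle_Rpower_l; [pose proof critical_exponent_gt_1; lra|].
      split; [lra|]. apply flow_ge_half; lra. }
    pose proof (Rpower_pos (/ 2) (q - 1)).
    specialize (hk t ltac:(lra)).
    apply Rmult_le_pos; [apply Rlt_le; pos | nra].
  - intros eps heps. exists (Rmin b (Rmin 1 (eps / initial_flux))).
    pose proof initial_flux_pos as hg.
    split.
    { apply Rmin_glb_lt; [|apply Rmin_glb_lt; [lra|pos]].
      unfold b. apply Rmin_glb_lt; [lra|apply half_life_pos]. }
    intros t ht.
    pose proof (Rmin_l b (Rmin 1 (eps / initial_flux))).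
    pose proof (Rmin_r b (Rmin 1 (eps / initial_flux))).
    pose proof (Rmin_l 1 (eps / initial_flux)).
    pose proof (Rmin_r 1 (eps / initial_flux)).
    destruct (hb t ltac:(lra)) as [h0 [h1 [h2 h3]]].
    destruct (proj1 hflow t ltac:(lra)) as [hv [hW _]].
    assert (Rpower t N <= t) by (apply Rpower_le_self; lra).
    assert (initial_flux * Rpower t N <= initial_flux * (eps / initial_flux))
      by (apply Rmult_le_compat_l; lra).
    replace (initial_flux * (eps / initial_flux)) with eps in * by (field; lra).
    lra.
  - split; [lra|]. unfold b. now apply Rmin_glb_lt.
Qed.

(** * Comparison with bubbles when the coefficient is nondecreasing *)

Context (k' : R -> R).
Context (hk' : forall s, 0 < s < S -> is_derive k s (k' s) /\ 0 <= k' s).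

Lemma pohozaev_small (eps : R) : 0 < T -> 0 < eps ->
  exists delta, 0 < delta <= Rmin T S /\
    forall t, 0 < t < delta -> Rabs (pohozaev N p k v W t) <= eps.
Proof.
  intros hT heps. pose proof coefficient_upper_pos as hk2. pose proof decay_exponent_pos as hm.
  set (c := Rpower (k2 / N) e).
  assert (hc : 0 < c) by (unfold c; pos).
  (* For t < 1 both W and t^N are O(t), while t w and v stay below [c] and 1; collecting these
     bounds gives |P(t)| <= a t. *)
  set (a := (p - 1) / p * (k2 / N) * (c + m) + (N - p) / (N * p) * k2).
  assert (ha : 0 < a).
  { assert (0 < c + m) by lra. unfold a. apply Rplus_lt_0_compat; pos. }
  exists (Rmin (Rmin T S) (Rmin 1 (eps / a))). split.
  { split; [|apply Rmin_l]. repeat apply Rmin_glb_lt; pos. }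
  intros t [ht0 ht].
  assert (htm : t < Rmin T S) by (eapply Rlt_le_trans; [apply ht|apply Rmin_l]).
  assert (htm' : t < Rmin 1 (eps / a)) by (eapply Rlt_le_trans; [apply ht|apply Rmin_r]).
  assert (htT : t < T) by (eapply Rlt_le_trans; [apply htm|apply Rmin_l]).
  assert (htS : t < S) by (eapply Rlt_le_trans; [apply htm|apply Rmin_r]).
  assert (ht1 : t < 1) by (eapply Rlt_le_trans; [apply htm'|apply Rmin_l]).
  assert (hta : t < eps / a) by (eapply Rlt_le_trans; [apply htm'|apply Rmin_r]).
  assert (hte : a * t <= eps).
  { replace eps with (a * (eps / a)) by (field; lra). apply Rmult_le_compat_l; lra. }
  destruct (proj1 hflow t ltac:(lra)) as [hv [hW _]].
  pose proof (flow_le_1 t ltac:(lra)) as hv1.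
  pose proof (flux_le t ltac:(lra)) as hW1.
  pose proof (speed_le t ltac:(lra)) as hw.
  assert (htN : Rpower t N <= t) by (apply Rpower_le_self; lra).
  assert (hte1 : Rpower t e <= 1).
  { apply Rpower_le_1; pose proof inv_sub_1_pos; lra. }
  assert (hvq : Rpower (v t) q <= 1).
  { apply Rpower_le_1; pose proof critical_exponent_gt_1; lra. }
  specialize (hk t ltac:(lra)).
  assert (hw0 : 0 < speed N p t (W t)) by apply Rpower_pos.
  set (w := speed N p t (W t)) in *.
  assert (hw1 : w <= c).
  { apply (Rle_trans _ _ _ hw). rewrite <- (Rmult_1_r c).
    apply Rmult_le_compat_l; [lra|exact hte1]. }
  assert (hWt : W t <= k2 / N * t).
  { apply (Rle_trans _ _ _ hW1). apply Rmult_le_compat_l; [apply Rlt_le; pos|exact htN]. }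
  assert (hkin : Rabs (kinetic_defect N p v W t) <= (p - 1) / p * (k2 / N * t) * (c + m)).
  { unfold kinetic_defect. rewrite Rabs_mult.
    rewrite (Rabs_pos_eq ((p - 1) / p * W t)) by (apply Rlt_le; pos).
    apply Rmult_le_compat.
    - apply Rlt_le; pos.
    - apply Rabs_pos.
    - apply Rmult_le_compat_l; [apply Rlt_le; pos | exact hWt].
    - fold w. apply Rabs_le.
      assert (0 < t * w) by pos. assert (t * w <= 1 * c) by (apply Rmult_le_compat; lra).
      assert (0 < m * v t) by pos. assert (m * v t <= m * 1) by (apply Rmult_le_compat_l; lra).
      lra. }
  assert (hpot : 0 <= k t * Rpower t N * Rpower (v t) q <= k2 * t).
  { pose proof (Rpower_pos t N). pose proof (Rpower_pos (v t) q).
    split; [apply Rlt_le; pos|].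
    rewrite <- (Rmult_1_r (k2 * t)).
    apply Rmult_le_compat; try lra; [apply Rlt_le; pos|].
    apply Rmult_le_compat; lra. }
  assert (hcoef : 0 < (N - p) / (N * p)) by pos.
  unfold pohozaev. eapply Rle_trans; [apply Rabs_triang|].
  rewrite (Rabs_pos_eq ((N - p) / (N * p) * _))
    by (apply Rmult_le_pos; lra).
  apply (Rle_trans _ (a * t)); [|exact hte].
  assert ((N - p) / (N * p) * (k t * Rpower t N * Rpower (v t) q)
          <= (N - p) / (N * p) * (k2 * t)) by (apply Rmult_le_compat_l; lra).
  apply Rle_trans with ((p - 1) / p * (k2 / N * t) * (c + m) + (N - p) / (N * p) * (k2 * t));
    [lra|].
  unfold a. right. ring.
Qed.

Lemma pohozaev_nonneg (s : R) : 0 < s < Rmin T S -> 0 <= pohozaev N p k v W s.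
Proof.
  intros hs.
  assert (hmin : forall t, t < Rmin T S -> t < T /\ t < S)
    by (intros t ht; split; eapply Rlt_le_trans; eauto; [apply Rmin_l|apply Rmin_r]).
  apply (ge_of_nondecreasing (pohozaev N p k v W) (Rmin T S)); trivial.
  - intros t ht. destruct (hmin t (proj2 ht)) as [htT htS].
    destruct (hk' t ltac:(lra)) as [dk hk0].
    eexists; split; [apply is_derive_pohozaev; [lra|exact dk]|].
    pose proof (Rpower_pos t N). pose proof (Rpower_pos (v t) q).
    apply Rmult_le_pos; [apply Rlt_le; pos|].
    apply Rmult_le_pos; [apply Rmult_le_pos; lra | lra].
  - intros eps heps. destruct (pohozaev_small eps) as [delta [hd h]]; trivial.
    { destruct (hmin s (proj2 hs)). lra. }
    exists delta. split; [lra|]. intros t ht. specialize (h t ht).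
    apply Rabs_le_between in h. lra.
Qed.

(* The quotient W s^(-N) v^(-N(p-1)/(N-p)) is constant on the Aubin-Talenti
   bubbles, and in general its derivative has the sign of the Pohozaev functional. *)
Lemma flux_ge_profile (s : R) : 0 < s < Rmin T S ->
  initial_flux * Rpower s N * Rpower (v s) (N * (p - 1) / (N - p)) <= W s.
Proof.
  intros hs.
  assert (hmin : forall t, t < Rmin T S -> t < T /\ t < S)
    by (intros t ht; split; eapply Rlt_le_trans; eauto; [apply Rmin_l|apply Rmin_r]).
  set (g := N * (p - 1) / (N - p)).
  assert (hg : 0 < g) by (unfold g; pos).
  pose proof initial_flux_pos as hi.
  assert (h : initial_flux <= W s * Rpower s (- N) * Rpower (v s) (- g)).
  { apply (ge_of_nondecreasing (fun t => W t * Rpower t (- N) * Rpower (v t) (- g)) (Rmin T S)); trivial.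
    - intros t ht. destruct (hmin t (proj2 ht)) as [htT htS].
      destruct (proj1 hflow t ltac:(lra)) as [hv [hW [dv dW]]].
      eexists. split; [derive_rules; lra|].
      change one with 1. change zero with 0.
      pose proof (pohozaev_nonneg t ht) as hP.
      apply Rle_trans with (Rpower t (- N) * Rpower (v t) (- g) * / t * / v t * q
                            * pohozaev N p k v W t).
      + pose proof critical_exponent_gt_1. apply Rmult_le_pos; [apply Rlt_le; pos|exact hP].
      + right. unfold pohozaev, kinetic_defect, g.
        rewrite (Rpower_pred t N), (Rpower_pred (v t) q) by lra.
        set (w := speed _ _ _ _). set (X := Rpower t (N - 1)).
        set (Y := Rpower (v t) (q - 1)). set (X' := Rpower t _). set (Y' := Rpower (v t) _).
        field. repeat split; lra.
    (* Near 0 the quotient is at least [initial_flux] by [flux_ge] and v <= 1. *)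
    - intros eps heps. exists (Rmin (Rmin T S) half_life).
      split; [apply Rmin_glb_lt; [lra|apply half_life_pos]|].
      intros t ht.
      pose proof (Rmin_l (Rmin T S) half_life). pose proof (Rmin_r (Rmin T S) half_life).
      destruct (hmin t ltac:(lra)) as [htT htS].
      destruct (proj1 hflow t ltac:(lra)) as [hv [hW _]].
      pose proof (flux_ge t ltac:(lra) ltac:(lra)) as hf.
      pose proof (flow_le_1 t ltac:(lra)) as hv1.
      assert (h1 : 1 <= Rpower (v t) (- g)).
      { apply Rpower_ge_1; lra. }
      assert (h2 : initial_flux <= W t * Rpower t (- N)).
      { replace initial_flux with (initial_flux * Rpower t N * Rpower t (- N)).
        - apply Rmult_le_compat_r; [apply Rlt_le; pos|exact hf].
        - rewrite Rmult_assoc, <- Rpower_plus, Rplus_opp_r, Rpower_O by lra. ring. }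
      assert (W t * Rpower t (- N) * 1 <= W t * Rpower t (- N) * Rpower (v t) (- g))
        by (apply Rmult_le_compat_l; lra).
      lra. }
  destruct (hmin s (proj2 hs)) as [hsT hsS].
  destruct (proj1 hflow s ltac:(lra)) as [hv [hW _]].
  apply (Rmult_le_compat_r (Rpower s N * Rpower (v s) g)) in h; [|apply Rlt_le; pos].
  replace (W s * _ * _ * _) with (W s) in h; [lra|].
  rpower.
Qed.

Definition decay_constant : R :=
  Rpower (Rpower initial_flux e * (p - 1) / (N - p)) (- ((N - p) / p)).

Lemma decay_constant_pos : 0 < decay_constant.
Proof. apply Rpower_pos. Qed.

(** By [flux_ge_profile], |v'| >= initial_flux^(1/(p-1)) s^(1/(p-1)) v^(N/(N-p)). This inequality
    separates: it bounds below the derivative of v^(-p/(N-p)), which on a bubble is an affine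
    function of s^(p/(p-1)). Integration gives the constant [c] of the proof. *)
Lemma flow_le_fast_decay (s : R) : 0 < s < Rmin T S ->
  v s <= decay_constant * Rpower s (- m).
Proof.
  intros hs.
  assert (hmin : forall t, t < Rmin T S -> t < T /\ t < S)
    by (intros t ht; split; eapply Rlt_le_trans; eauto; [apply Rmin_l|apply Rmin_r]).
  pose proof initial_flux_pos as hi.
  set (c := Rpower initial_flux e * (p - 1) / (N - p)).
  assert (hc : 0 < c) by (unfold c; pos).
  set (b := p / (N - p)). assert (hb : 0 < b) by (unfold b; pos).
  assert (h : 0 <= Rpower (v s) (- b) - c * Rpower s (p / (p - 1))).
  { apply (ge_of_nondecreasing
      (fun t => Rpower (v t) (- b) - c * Rpower t (p / (p - 1))) (Rmin T S)); trivial.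
    - intros t ht. destruct (hmin t (proj2 ht)) as [htT htS].
      destruct (proj1 hflow t ltac:(lra)) as [hv [hW [dv dW]]].
      eexists. split; [derive_rules; lra|].
      change one with 1. change zero with 0.
      assert (hw : Rpower initial_flux e * Rpower t e * Rpower (v t) (N / (N - p))
                   <= speed N p t (W t)).
      { apply Rle_trans with
          (Rpower (initial_flux * Rpower t N * Rpower (v t) (N * (p - 1) / (N - p))
                   * Rpower t (1 - N)) e).
        - right. rpower.
        - apply Rle_Rpower_l; [pose proof inv_sub_1_pos; lra|]. split; [pos|].
          apply Rmult_le_compat_r; [apply Rlt_le; pos|]. now apply flux_ge_profile. }
      assert (h1 : Rpower (v t) (- b) / v t * Rpower (v t) (N / (N - p)) = 1).
      { apply ln_inv; [pos|pos|]. unfold b. rewrite ln_mult, ln_div, !ln_Rpower, ln_1 by pos.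
        field. lra. }
      assert (h2 : 0 < Rpower (v t) (- b) / v t) by pos.
      apply (Rmult_le_compat_l (b * (Rpower (v t) (- b) / v t))) in hw;
        [|apply Rlt_le; pos].
      replace (b * (Rpower (v t) (- b) / v t) *
          (Rpower initial_flux e * Rpower t e * Rpower (v t) (N / (N - p))))
        with (b * (Rpower initial_flux e * Rpower t e)) in hw.
      2:{ transitivity (b * (Rpower initial_flux e * Rpower t e)
            * (Rpower (v t) (- b) / v t * Rpower (v t) (N / (N - p)))); [|ring].
          rewrite h1. ring. }
      match goal with |- 0 <= ?x => replace x with
        (b * (Rpower (v t) (- b) / v t) * speed N p t (W t)
         - b * (Rpower initial_flux e * Rpower t e)) end; [lra|].
      rewrite (Rpower_pred t (p / (p - 1))) by lra.
      replace (p / (p - 1) - 1) with e by (field; lra).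
      unfold c, b. set (X := Rpower (v t) _). set (Y := Rpower t _).
      field. repeat split; lra.
    - intros eps heps.
      exists (Rmin (Rmin T S) (Rpower (/ c) ((p - 1) / p))).
      split; [apply Rmin_glb_lt; [lra|pos]|]. intros t ht.
      pose proof (Rmin_l (Rmin T S) (Rpower (/ c) ((p - 1) / p))).
      pose proof (Rmin_r (Rmin T S) (Rpower (/ c) ((p - 1) / p))).
      destruct (hmin t ltac:(lra)) as [htT htS].
      destruct (proj1 hflow t ltac:(lra)) as [hv _].
      pose proof (flow_le_1 t ltac:(lra)) as hv1.
      assert (h1 : 1 <= Rpower (v t) (- b)).
      { apply Rpower_ge_1; lra. }
      assert (h2 : Rpower t (p / (p - 1)) <= / c).
      { replace (/ c) with (Rpower (Rpower (/ c) ((p - 1) / p)) (p / (p - 1))).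
        - apply Rle_Rpower_l; [apply Rlt_le; pos|lra].
        - rewrite Rpower_mult. replace ((p - 1) / p * (p / (p - 1))) with 1 by (field; lra).
          apply Rpower_1. pos. }
      apply (Rmult_le_compat_l c) in h2; [|lra].
      rewrite Rinv_r in h2 by lra. lra. }
  destruct (hmin s (proj2 hs)) as [hsT hsS].
  destruct (proj1 hflow s ltac:(lra)) as [hv _].
  assert (h1 : Rpower (Rpower (v s) (- b)) (- ((N - p) / p))
               <= Rpower (c * Rpower s (p / (p - 1))) (- ((N - p) / p))).
  { apply Rpower_neg_le.
    - assert (0 < (N - p) / p) by pos. lra.
    - split; [pos|lra]. }
  rewrite Rpower_mult in h1.
  replace (- b * - ((N - p) / p)) with 1 in h1 by (unfold b; field; lra).
  rewrite Rpower_1 in h1 by exact hv.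
  apply (Rle_trans _ _ _ h1). right. unfold decay_constant. fold c. rpower.
Qed.

(** The exponent is N - m q = -N/(p-1). *)
Lemma potential_le_fast (s : R) : 0 < s < Rmin T S ->
  Rpower s N * Rpower (v s) q <= Rpower decay_constant q * Rpower s (- (N / (p - 1))).
Proof.
  intros hs.
  assert (hT : s < T) by (eapply Rlt_le_trans; [apply hs|apply Rmin_l]).
  destruct (proj1 hflow s ltac:(lra)) as [hv _].
  pose proof decay_constant_pos.
  apply Rle_trans with (Rpower s N * Rpower (decay_constant * Rpower s (- m)) q).
  - apply Rmult_le_compat_l; [apply Rlt_le; pos|].
    apply Rle_Rpower_l; [pose proof critical_exponent_gt_1; lra|]. split; [exact hv|].
    now apply flow_le_fast_decay.
  - right. rpower.
Qed.

(** Below s = 1 the potential is at most 1, above it the fast decay applies. The freedom in [a] lets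
    the rate be weakened until its product with s^(l-1) is integrable at 0. *)
Lemma potential_le (a s : R) : 0 <= a <= N / (p - 1) -> 0 < s < Rmin T S ->
  Rpower s N * Rpower (v s) q <= (1 + Rpower decay_constant q) * Rpower s (- a).
Proof.
  intros ha hs.
  assert (hT : s < T) by (eapply Rlt_le_trans; [apply hs|apply Rmin_l]).
  destruct (proj1 hflow s ltac:(lra)) as [hv _].
  pose proof (Rpower_pos decay_constant q) as hC.
  pose proof (Rpower_pos s (- a)) as hsa.
  destruct (Rle_dec s 1) as [h1|h1].
  - assert (Rpower s N <= 1) by (apply Rpower_le_1; lra).
    assert (Rpower (v s) q <= 1).
    { apply Rpower_le_1; [pose proof critical_exponent_gt_1; lra|]. split; [exact hv|].
      apply flow_le_1. lra. }
    assert (1 <= Rpower s (- a)) by (apply Rpower_ge_1; lra).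
    pose proof (Rpower_pos s N). pose proof (Rpower_pos (v s) q). nra.
  - apply (Rle_trans _ _ _ (potential_le_fast s hs)).
    assert (Rpower s (- (N / (p - 1))) <= Rpower s (- a)) by (apply Rle_Rpower; lra).
    nra.
Qed.

(** P' is at most a constant times t^(l-l'-1), integrable at 0 as l' < l. The full rate N/(p-1)
    would produce a logarithm when l = N/(p-1). *)
Lemma pohozaev_le (b l l' s : R) :
  0 < b -> 0 <= l' < l -> l <= N / (p - 1) ->
  (forall t, 0 < t < S -> k' t <= b * Rpower t (l - 1)) ->
  0 < s < Rmin T S ->
  pohozaev N p k v W s
  <= (N - p) / (N * p) * (1 + Rpower decay_constant q) / (l - l') * b * Rpower s (l - l').
Proof.
  intros hb hl' hl hk'b hs.
  set (C := (N - p) / (N * p) * (1 + Rpower decay_constant q) / (l - l')).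
  pose proof (Rpower_pos decay_constant q) as hC0.
  assert (hC : 0 < C) by (unfold C; pos).
  enough (0 <= C * b * Rpower s (l - l') - pohozaev N p k v W s) by lra.
  apply (ge_of_nondecreasing
    (fun t => C * b * Rpower t (l - l') - pohozaev N p k v W t) (Rmin T S)); trivial.
  - intros t ht.
    assert (htT : t < T) by (eapply Rlt_le_trans; [apply ht|apply Rmin_l]).
    assert (htS : t < S) by (eapply Rlt_le_trans; [apply ht|apply Rmin_r]).
    destruct (hk' t ltac:(lra)) as [dk hk0].
    pose proof (is_derive_pohozaev t _ ltac:(lra) dk) as dP.
    eexists; split; [derive_rules; lra|].
    change one with 1. change zero with 0.
    pose proof (potential_le l' t ltac:(lra) ht) as hpot.
    assert (h : k' t * (Rpower t N * Rpower (v t) q)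
                <= b * Rpower t (l - 1) * ((1 + Rpower decay_constant q) * Rpower t (- l'))).
    { pose proof (Rpower_pos t N). pose proof (Rpower_pos (v t) q).
      apply Rmult_le_compat; trivial.
      - apply Rlt_le; pos.
      - apply hk'b. lra. }
    replace (b * Rpower t (l - 1) * ((1 + Rpower decay_constant q) * Rpower t (- l')))
      with (b * (1 + Rpower decay_constant q) * (Rpower t (l - l') / t)) in h.
    2:{ replace (Rpower t (l - l') / t) with (Rpower t (l - 1) * Rpower t (- l')) by rpower.
        ring. }
    assert (hcoef : 0 < (N - p) / (N * p)) by pos.
    apply (Rmult_le_compat_l ((N - p) / (N * p))) in h; [|lra].
    match goal with |- 0 <= ?x => replace x with
      ((N - p) / (N * p) * (b * (1 + Rpower decay_constant q) * (Rpower t (l - l') / t))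
       - (N - p) / (N * p) * (k' t * (Rpower t N * Rpower (v t) q))) end; [lra|].
    unfold C. set (X := Rpower t (l - l')). set (Y := Rpower t N).
    set (Z := Rpower (v t) q). field. repeat split; lra.
  - intros eps heps. destruct (pohozaev_small eps) as [delta [hd h]]; trivial.
    { assert (s < T) by (eapply Rlt_le_trans; [apply hs|apply Rmin_l]). lra. }
    exists delta. split; [lra|]. intros t ht. specialize (h t ht).
    apply Rabs_le_between in h.
    assert (0 < C * b * Rpower t (l - l')) by pos. lra.
Qed.

(** The lower bounds on k' and v give P' >= const t^(l-N/(p-1)) / t. Since l <= N/(p-1), the power
    is at least its value at S, and 1/t integrates to the logarithm; P(x) >= 0 is dropped. *)
Lemma pohozaev_ge_log (b c l x y : R) :
  0 < b -> 0 < c -> 0 < x -> x <= y -> y < Rmin T S -> l <= N / (p - 1) ->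
  (forall t, 0 < t < S -> b * Rpower t (l - 1) <= k' t) ->
  (forall t, x <= t <= y -> c * Rpower t (- m) <= v t) ->
  (N - p) / (N * p) * b * Rpower c q * Rpower S (l - N / (p - 1)) * (ln y - ln x)
  <= pohozaev N p k v W y.
Proof.
  intros hb hc hx hxy hy hl hk'b hv.
  set (D := (N - p) / (N * p) * b * Rpower c q * Rpower S (l - N / (p - 1))).
  enough (h : pohozaev N p k v W x - D * ln x <= pohozaev N p k v W y - D * ln y).
  { pose proof (pohozaev_nonneg x ltac:(lra)). lra. }
  apply (nondecreasing_of_derive (fun t => pohozaev N p k v W t - D * ln t)); try lra.
  intros t ht.
  assert (htT : t < T) by (eapply Rle_lt_trans; [apply ht|eapply Rlt_le_trans; [apply hy|apply Rmin_l]]).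
  assert (htS : t < S) by (eapply Rle_lt_trans; [apply ht|eapply Rlt_le_trans; [apply hy|apply Rmin_r]]).
  destruct (hk' t ltac:(lra)) as [dk hk0].
  pose proof (is_derive_pohozaev t _ ltac:(lra) dk) as dP.
  pose proof (is_derive_ln t ltac:(lra)) as dln.
  eexists; split; [derive_rules; exact dln|].
  change one with 1. change zero with 0.
  assert (h : b * Rpower t (l - 1) * (Rpower t N * Rpower (c * Rpower t (- m)) q)
              <= k' t * (Rpower t N * Rpower (v t) q)).
  { apply Rmult_le_compat; [apply Rlt_le; pos|apply Rlt_le; pos|apply hk'b; lra|].
    apply Rmult_le_compat_l; [apply Rlt_le; pos|].
    apply Rle_Rpower_l; [pose proof critical_exponent_gt_1; lra|]. split; [pos|now apply hv]. }
  replace (b * Rpower t (l - 1) * (Rpower t N * Rpower (c * Rpower t (- m)) q))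
    with (b * Rpower c q * Rpower t (l - N / (p - 1)) * / t) in h by rpower.
  assert (h1 : Rpower S (l - N / (p - 1)) <= Rpower t (l - N / (p - 1)))
    by (apply Rpower_neg_le; lra).
  assert (h2 : b * Rpower c q * Rpower S (l - N / (p - 1)) * / t
               <= b * Rpower c q * Rpower t (l - N / (p - 1)) * / t).
  { apply Rmult_le_compat_r; [apply Rlt_le; pos|].
    apply Rmult_le_compat_l; [apply Rlt_le; pos|exact h1]. }
  assert (hcoef : 0 < (N - p) / (N * p)) by pos.
  unfold D.
  match goal with |- 0 <= ?x => replace x with ((N - p) / (N * p) *
    (k' t * (Rpower t N * Rpower (v t) q)
     - b * Rpower c q * Rpower S (l - N / (p - 1)) * / t)) by ring end.
  apply Rmult_le_pos; lra.
Qed.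

(** * Bounds on the kinetic part and their effect on s^m v *)

Lemma kinetic_defect_le_pohozaev (s : R) : 0 < s < Rmin T S ->
  kinetic_defect N p v W s <= pohozaev N p k v W s.
Proof.
  intros hs.
  assert (hsS : s < S) by (eapply Rlt_le_trans; [apply hs|apply Rmin_r]).
  specialize (hk s ltac:(lra)). unfold pohozaev.
  assert (0 < (N - p) / (N * p) * (k s * Rpower s N * Rpower (v s) q)) by pos. lra.
Qed.

(** No derivative of k enters, so this reaches beyond [S]. The only positive term in the derivative
    of the kinetic part is k s^N v^(q-1) w <= kX X^N v^(q-1) w, and the bound is minus the
    derivative of kX X^N v^q / q. *)
Lemma kinetic_defect_le (X kX x y : R) :
  (forall s, 0 < s < X -> 0 <= k s <= kX) ->
  0 < x -> x <= y -> y < Rmin T X ->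
  kinetic_defect N p v W y
  <= kinetic_defect N p v W x + (N - p) / (N * p) * (kX * Rpower X N) * Rpower (v x) q.
Proof.
  intros hkX hx hxy hy.
  set (D := (N - p) / (N * p) * (kX * Rpower X N)).
  enough (h : - (kinetic_defect N p v W x + D * Rpower (v x) q)
              <= - (kinetic_defect N p v W y + D * Rpower (v y) q)).
  { assert (hyT : y < T) by (eapply Rlt_le_trans; [apply hy|apply Rmin_l]).
    assert (hyX : y < X) by (eapply Rlt_le_trans; [apply hy|apply Rmin_r]).
    assert (hD : 0 <= D).
    { specialize (hkX y ltac:(lra)). pose proof (Rpower_pos X N). unfold D.
      apply Rmult_le_pos; [apply Rlt_le; pos|]. apply Rmult_le_pos; lra. }
    pose proof (Rmult_le_pos _ _ hD (Rlt_le _ _ (Rpower_pos (v y) q))). lra. }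
  apply (nondecreasing_of_derive
    (fun t => - (kinetic_defect N p v W t + D * Rpower (v t) q))); trivial.
  intros t ht.
  assert (htT : t < T) by (eapply Rle_lt_trans; [apply ht|eapply Rlt_le_trans; [apply hy|apply Rmin_l]]).
  assert (htX : t < X) by (eapply Rle_lt_trans; [apply ht|eapply Rlt_le_trans; [apply hy|apply Rmin_r]]).
  pose proof (is_derive_kinetic_defect t ltac:(lra)) as dkin.
  destruct (proj1 hflow t ltac:(lra)) as [hv [hW [dv dW]]].
  eexists; split.
  - apply (is_derive_opp (K := R_AbsRing) (V := R_NormedModule)
      (fun t => kinetic_defect N p v W t + D * Rpower (v t) q)).
    derive_rules; lra.
  - change one with 1. change zero with 0. change (opp ?x) with (- x).
    specialize (hkX t ltac:(lra)).
    assert (hw : 0 < speed N p t (W t)) by apply Rpower_pos.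
    set (w := speed N p t (W t)) in *.
    assert (hN : k t * Rpower t N <= kX * Rpower X N).
    { apply Rmult_le_compat; try lra; [apply Rlt_le; pos|]. apply Rle_Rpower_l; lra. }
    pose proof (Rpower_pos (v t) (q - 1)) as hY.
    pose proof (Rpower_pos t (N - 1)) as hX.
    match goal with |- 0 <= ?x => replace x with
      (Rpower (v t) (q - 1) * (w * (kX * Rpower X N - k t * Rpower t N)
         + Rpower t (N - 1) * k t * ((N - p) / p * v t))) end.
    + apply Rmult_le_pos; [lra|]. apply Rplus_le_le_0_compat.
      * apply Rmult_le_pos; lra.
      * repeat apply Rmult_le_pos; try lra. apply Rlt_le; pos.
    + rewrite (Rpower_pred t N), (Rpower_pred (v t) q) by lra.
      unfold opp; simpl. unfold D. fold w.
      set (Y := Rpower (v t) (q - 1)). set (Z := Rpower t (N - 1)).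
      set (U := Rpower X N). field. repeat split; lra.
Qed.

(* The derivative of s^m v is -s^(m-1) (s w - m v), where w = -v'. *)
Lemma fast_decay_lower_bound (E W0 x y : R) :
  0 < x -> x <= y -> y < T -> 0 <= E -> 0 < W0 ->
  (forall s, x <= s <= y -> kinetic_defect N p v W s <= E /\ W0 <= W s) ->
  Rpower x m * v x <= Rpower y m * v y + Rpower y m * (p * E / ((N - p) * W0)).
Proof.
  intros hx hxy hy hE hW0 h.
  (* The hypotheses give s w - m v <= p E / ((p-1) W0) = m D, so adding D to v makes s^m (v + D)
     nondecreasing. *)
  set (D := p * E / ((N - p) * W0)).
  assert (hD : 0 <= D).
  { unfold D. apply Rmult_le_pos; [apply Rmult_le_pos; lra|]. apply Rlt_le; pos. }
  enough (Rpower x m * (v x + D) <= Rpower y m * (v y + D)).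
  { pose proof (Rpower_pos x m). nra. }
  apply (nondecreasing_of_derive (fun t => Rpower t m * (v t + D))); trivial.
  intros t ht. destruct (h t ht) as [hdef hWt].
  destruct (proj1 hflow t ltac:(lra)) as [hv [hW [dv dW]]].
  eexists; split; [derive_rules; lra|].
  change one with 1. change zero with 0.
  assert (hw : t * speed N p t (W t) - m * v t <= m * D).
  { unfold kinetic_defect in hdef. unfold D.
    set (z := t * speed N p t (W t) - m * v t) in *.
    destruct (Rle_dec z 0) as [hz|hz].
    - apply (Rle_trans _ 0); trivial. pose proof decay_exponent_pos.
      apply Rmult_le_pos; [lra|exact hD].
    - assert (hz1 : (p - 1) / p * W0 * z <= E).
      { apply (Rle_trans _ ((p - 1) / p * W t * z)); trivial.
        apply Rmult_le_compat_r; [lra|]. apply Rmult_le_compat_l; [apply Rlt_le; pos|lra]. }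
      apply (Rmult_le_compat_r (p / ((p - 1) * W0))) in hz1; [|apply Rlt_le; pos].
      match type of hz1 with ?l <= ?r =>
        replace l with z in hz1 by (field; repeat split; lra);
        replace (m * (p * E / ((N - p) * W0))) with r by (field; repeat split; lra) end.
      exact hz1. }
  pose proof (Rpower_pos t m) as hX.
  match goal with |- 0 <= ?x => replace x with
    (Rpower t m / t * (m * D - (t * speed N p t (W t) - m * v t))) end.
  - apply Rmult_le_pos; [apply Rlt_le; pos|lra].
  - set (w := speed _ _ _ _). set (X := Rpower t m). field. repeat split; lra.
Qed.

End Flow.

(** As W increases, |v'(t)| >= W(s)^(1/(p-1)) t^(-m-1) for t >= s. Integrating to infinity with v >
    0 yields v(s) >= a s^(-m), and m a s^(-m) is exactly s |v'(s)|. *)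
Lemma kinetic_defect_nonpos_of_global (N p : R) (k v W : R -> R) (s : R) :
  1 < p < N -> (forall T, regular_flow N p k v W T) ->
  (forall t, 0 < t -> 0 < k t) -> 0 < s ->
  kinetic_defect N p v W s <= 0.
Proof.
  intros hp hflow hk hs.
  destruct (proj1 (hflow (s + 1)) s ltac:(lra)) as [hv [hW _]].
  set (m := (N - p) / (p - 1)). assert (hm : 0 < m) by (unfold m; pos).
  set (a := Rpower (W s) (/ (p - 1)) / m).
  assert (ha : 0 < a) by (unfold a; pos).
  assert (h : 0 <= v s - a * Rpower s (- m)).
  { apply le_epsilon. intros eps heps.
    destruct (Rpower_small_at_infinity (- m) (eps / a)) as [x hx]; [lra|pos|].
    (* At [y] the tail a y^(-m) is below eps, and v(y) > 0 can be discarded. *)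
    set (y := Rmax (x + 1) (s + 1)).
    assert (hy1 : x + 1 <= y) by apply Rmax_l.
    assert (hy2 : s + 1 <= y) by apply Rmax_r.
    specialize (hx y ltac:(lra)).
    apply (Rmult_lt_compat_l a) in hx; [|lra].
    replace (a * (eps / a)) with eps in hx by (field; lra).
    destruct (proj1 (hflow (y + 1)) y ltac:(lra)) as [hvy _].
    enough (a * Rpower s (- m) - v s <= a * Rpower y (- m) - v y) by lra.
    apply (nondecreasing_of_derive (fun t => a * Rpower t (- m) - v t)); [lra|].
    intros t ht. destruct (proj1 (hflow (y + 1)) t ltac:(lra)) as [hvt [hWt [dv dW]]].
    eexists; split; [derive_rules; lra|].
    change one with 1. change zero with 0.
    assert (hc : W s <= W t).
    { apply (flux_nondecreasing N p k v W (y + 1)); trivial; try lra.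
      intros r hr. apply hk. lra. }
    assert (hw : Rpower (W s * Rpower t (1 - N)) (/ (p - 1)) <= speed N p t (W t)).
    { apply Rle_Rpower_l; [apply Rlt_le; pos|]. split; [pos|].
      apply Rmult_le_compat_r; [apply Rlt_le; pos|exact hc]. }
    replace (Rpower (W s * Rpower t (1 - N)) (/ (p - 1)))
      with (a * m * Rpower t (- m) / t) in hw.
    - set (X := Rpower t (- m)) in *. lra.
    - replace (a * m) with (Rpower (W s) (/ (p - 1))) by (unfold a; field; lra).
      unfold m. rpower. }
  unfold kinetic_defect. fold m.
  assert (hw : a * Rpower s (- m) * m = s * speed N p s (W s)).
  { replace (a * Rpower s (- m) * m) with (Rpower (W s) (/ (p - 1)) * Rpower s (- m))
      by (unfold a; field; lra).
    unfold m, speed. rpower. }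
  rewrite <- hw.
  replace (_ * (_ - _)) with (- ((p - 1) / p * W s * m * (v s - a * Rpower s (- m)))) by ring.
  assert (0 < (p - 1) / p * W s * m) by pos.
  pose proof (Rmult_le_pos _ _ (Rlt_le _ _ H) h). lra.
Qed.

(** * Large scaling parameter *)

Section Rescaled.

Context (N p : R) (hp : 1 < p < N).

Local Notation q := (N * p / (N - p)).
Local Notation m := ((N - p) / (p - 1)).

Context (K K' : R -> R) (k1 k2 rho b1 b2 l : R).
Context (hl : m < l <= N / (p - 1)).
Context (hk1 : 0 < k1) (hrho : 0 < rho) (hb1 : 0 < b1) (hb2 : 0 < b2).
Context (hKpos : forall r, 0 < r -> 0 < K r).
Context (hKnear : forall r, 0 < r < rho -> k1 <= K r <= k2).
Context (hK' : forall r, 0 < r < rho -> is_derive K r (K' r) /\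
  b1 * Rpower r (l - 1) <= K' r <= b2 * Rpower r (l - 1)).

Lemma rescaled_range (lam s X : R) : 0 < lam -> 0 < s < lam * X -> 0 < s / lam < X.
Proof.
  intros hlam hs. split; [pos|]. apply (Rmult_lt_reg_r lam); [exact hlam|].
  replace (s / lam * lam) with s by (field; lra). lra.
Qed.

Lemma rescaled_bounds (lam s : R) : 0 < lam -> 0 < s < lam * rho ->
  k1 <= K (s / lam) <= k2.
Proof. intros hlam hs. apply hKnear. now apply rescaled_range. Qed.

Lemma rescaled_derive (lam s : R) : 0 < lam -> 0 < s < lam * rho ->
  is_derive (fun t => K (t / lam)) s (K' (s / lam) / lam) /\
  b1 * Rpower lam (- l) * Rpower s (l - 1) <= K' (s / lam) / lam
  <= b2 * Rpower lam (- l) * Rpower s (l - 1).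
Proof.
  intros hlam hs. pose proof (rescaled_range lam s rho hlam hs) as hr.
  destruct (hK' _ hr) as [dK [h1 h2]].
  split.
  - eapply is_derive_R_eq.
    + apply (is_derive_comp K (fun t => t / lam) s); [exact dK|].
      apply (is_derive_R_mult (fun t => t) (fun _ => / lam)); derive_rules.
    + change one with 1. change zero with 0.
      unfold scal; simpl; unfold mult; simpl. field. lra.
  - assert (he : forall b, b * Rpower lam (- l) * Rpower s (l - 1)
      = b * Rpower (s / lam) (l - 1) / lam).
    { intros b.
      assert (h : Rpower (s / lam) (l - 1) / lam = Rpower lam (- l) * Rpower s (l - 1))
        by rpower.
      rewrite Rmult_assoc, <- h. field. lra. }
    rewrite !he.
    split; apply Rmult_le_compat_r; trivial; try (apply Rlt_le; pos).
Qed.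

Lemma rescaled_derive_nonneg (lam s : R) : 0 < lam -> 0 < s < lam * rho ->
  is_derive (fun t => K (t / lam)) s (K' (s / lam) / lam) /\ 0 <= K' (s / lam) / lam.
Proof.
  intros hlam hs. destruct (rescaled_derive lam s hlam hs) as [h [h1 _]].
  split; trivial. apply (Rle_trans _ _ _) with (2 := h1). apply Rlt_le; pos.
Qed.

(** The constants precede [lam], [v], [W] and [T], so the bound is uniform. It is used with a large
    M to keep zeros away, and with M = rho to make the Pohozaev functional large. *)
Lemma rescaled_lower_bound (M kM : R) : 0 < M -> (forall r, 0 < r < M -> K r <= kM) ->
  exists c X, 0 < c /\ 0 < X /\ forall lam, X < lam ->
    2 * (half_life N p k2 / 2) < lam * rho /\
    forall v W T,
    regular_flow N p (fun s => K (s / lam)) v W T ->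
    (forall s, 0 < s < T -> s <= half_life N p k2 / 2 -> / 2 <= v s) /\
    forall s, half_life N p k2 / 2 <= s -> s < Rmin T (lam * M) ->
    c * Rpower s (- m) <= v s.
Proof.
  intros hM hkM.
  pose proof (half_life_pos N p k2) as hhl.
  set (a := half_life N p k2 / 2). assert (ha : 0 < a) by (unfold a; lra).
  set (C := decay_constant N p k1).
  (* Any l' strictly between m and l works: l' < l for [pohozaev_le], l' > m so that lambda^m
     lambda^(-l') tends to 0. *)
  set (l' := (m + l) / 2).
  assert (hm : 0 < m) by pos.
  assert (hl' : m < l' < l) by (unfold l'; lra).
  assert (hNe : m < N / (p - 1)).
  { apply (Rmult_lt_reg_r (p - 1)); [lra|].
    replace (m * (p - 1)) with (N - p) by (field; lra).
    replace (N / (p - 1) * (p - 1)) with N by (field; lra). lra. }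
  assert (hkM0 : 0 < kM).
  { specialize (hkM (M / 2) ltac:(lra)). specialize (hKpos (M / 2) ltac:(lra)). lra. }
  set (W0 := initial_flux N p k1 * Rpower a N).
  assert (hi : 0 < initial_flux N p k1) by (unfold initial_flux; pos).
  assert (hW0 : 0 < W0) by (unfold W0; pos).
  set (C1 := (N - p) / (N * p) * (1 + Rpower C q) / (l - l')).
  assert (hC1 : 0 < C1).
  { unfold C1. pose proof (Rpower_pos C q). pos. }
  (* [D1] and [D2] are the errors [E1] and [E2] below, stripped of their powers lambda^(-l') and
     lambda^(-N/(p-1)). *)
  set (D1 := C1 * b2 * Rpower (rho / 2) (l - l')).
  assert (hD1 : 0 < D1) by (unfold D1; pos).
  set (D2 := (N - p) / (N * p) * (kM * Rpower (2 * M / rho) N)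
             * (Rpower C q * Rpower (rho / 2) (- (N / (p - 1))))).
  assert (hD2 : 0 < D2) by (unfold D2; pos).
  set (F := Rpower M m * (p / ((N - p) * W0))).
  assert (hF : 0 < F) by (unfold F; pos).
  (* Initially a^m v(a) >= a^m / 2 = 2 c. For large lambda each of the two errors costs at most c /
     2, which leaves c. *)
  set (c := Rpower a m / 4). assert (hc : 0 < c) by (unfold c; pos).
  destruct (Rpower_small_at_infinity (m - l') (c / 2 / F / D1)) as [X1 hX1];
    [lra|pos|].
  destruct (Rpower_small_at_infinity (m - N / (p - 1)) (c / 2 / F / D2)) as [X2 hX2];
    [lra|pos|].
  set (X3 := 2 * a / rho). assert (hX3 : 0 < X3) by (unfold X3; pos).
  exists c, (Rmax X3 (Rmax X1 X2)).
  assert (hX : 0 < Rmax X3 (Rmax X1 X2)) by (eapply Rlt_le_trans; [exact hX3|apply Rmax_l]).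
  split; [exact hc|]. split; [exact hX|].
  intros lam hlam.
  assert (hlam1 : X1 < lam).
  { eapply Rle_lt_trans; [|exact hlam]. eapply Rle_trans; [apply Rmax_l|apply Rmax_r]. }
  assert (hlam2 : X2 < lam).
  { eapply Rle_lt_trans; [|exact hlam]. eapply Rle_trans; [apply Rmax_r|apply Rmax_r]. }
  assert (hlam3 : X3 < lam) by (eapply Rle_lt_trans; [|exact hlam]; apply Rmax_l).
  assert (hlam0 : 0 < lam) by lra.
  specialize (hX1 lam hlam1). specialize (hX2 lam hlam2).
  assert (hS : 2 * a < lam * rho).
  { apply (Rmult_lt_compat_r rho) in hlam3; [|lra]. unfold X3 in hlam3.
    replace (2 * a / rho * rho) with (2 * a) in hlam3 by (field; lra). lra. }
  split; [exact hS|].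
  intros v W T hflow.
  set (k := fun s => K (s / lam)) in *.
  pose proof (fun s => rescaled_bounds lam s hlam0) as hk. fold k in hk.
  change (forall s, 0 < s < lam * rho -> k1 <= k s <= k2) in hk.
  assert (hS0 : 0 < lam * rho) by lra.
  assert (hhalf : forall s, 0 < s < T -> s <= a -> / 2 <= v s).
  { intros s hs hsa.
    apply (flow_ge_half N p hp k v W T hflow k1 k2 (lam * rho) hk1 hk hS0).
    - split; [lra|apply Rmin_glb_lt; lra].
    - unfold a in hsa. lra. }
  split; [exact hhalf|]. intros s has hs.
  assert (hsT : s < T) by (eapply Rlt_le_trans; [apply hs|apply Rmin_l]).
  assert (hsM : s < lam * M) by (eapply Rlt_le_trans; [apply hs|apply Rmin_r]).
  pose proof (fun s => rescaled_derive_nonneg lam s hlam0) as hdk.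
  change (forall s, 0 < s < lam * rho ->
    is_derive k s (K' (s / lam) / lam) /\ 0 <= K' (s / lam) / lam) in hdk.
  (* Up to [s0] the Pohozaev identity gives the error [E1]; beyond it [kinetic_defect_le] adds
     [E2]. *)
  set (s0 := lam * rho / 2).
  set (E1 := C1 * (b2 * Rpower lam (- l)) * Rpower s0 (l - l')).
  set (E2 := (N - p) / (N * p) * (kM * Rpower (2 * M / rho) N)
             * (Rpower C q * Rpower s0 (- (N / (p - 1))))).
  assert (hs0 : 0 < s0) by (unfold s0; lra).
  assert (hE1 : 0 < E1) by (unfold E1; pos).
  assert (hE2 : 0 < E2) by (unfold E2; pos).
  assert (hdef1 : forall t, 0 < t < T -> t <= s0 -> kinetic_defect N p v W t <= E1).
  { intros t ht hts.
    assert (htm : 0 < t < Rmin T (lam * rho))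
      by (split; [lra|apply Rmin_glb_lt; unfold s0 in hts; lra]).
    eapply Rle_trans;
      [apply (kinetic_defect_le_pohozaev N p hp k v W T k1 k2 _ hk1 hk); trivial|].
    eapply Rle_trans;
      [apply (pohozaev_le N p hp k v W T hflow k1 k2 (lam * rho) hk1 hk hS0
         (fun t => K' (t / lam) / lam) hdk (b2 * Rpower lam (- l)) l l'); trivial; try pos|].
    - intros r hr. apply (rescaled_derive lam r hlam0 hr).
    - fold C. fold C1. unfold E1. apply Rmult_le_compat_l; [apply Rlt_le; pos|].
      apply Rle_Rpower_l; lra. }
  assert (hdef : forall t, 0 < t < Rmin T (lam * M) -> kinetic_defect N p v W t <= E1 + E2).
  { intros t ht.
    assert (htT : t < T) by (eapply Rlt_le_trans; [apply ht|apply Rmin_l]).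
    destruct (Rle_dec t s0) as [hts|hts].
    - specialize (hdef1 t ltac:(lra) hts). lra.
    - apply Rnot_le_lt in hts.
      eapply Rle_trans;
        [apply (kinetic_defect_le N p hp k v W T hflow (lam * M) kM s0 t); try lra|].
      + intros r hr. pose proof (rescaled_range lam r M hlam0 hr) as hr'.
        split; [apply Rlt_le, hKpos; lra|now apply hkM].
      + specialize (hdef1 s0 ltac:(lra) ltac:(lra)).
        assert (hpot : Rpower s0 N * Rpower (v s0) q
                       <= Rpower C q * Rpower s0 (- (N / (p - 1)))).
        { apply (potential_le_fast N p hp k v W T hflow k1 k2 (lam * rho) hk1 hk hS0
            (fun t => K' (t / lam) / lam) hdk).
          split; [lra|]. apply Rmin_glb_lt; unfold s0 in *; lra. }
        assert (hcoef : 0 < (N - p) / (N * p) * (kM * Rpower (2 * M / rho) N)) by pos.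
        apply (Rmult_le_compat_l _ _ _ (Rlt_le _ _ hcoef)) in hpot. fold E2 in hpot.
        (* This makes the potential s0^N v(s0)^q appear, which the fast decay controls. *)
        replace (Rpower (lam * M) N) with (Rpower (2 * M / rho) N * Rpower s0 N).
        2:{ rewrite Rpower_mult_distr by pos. f_equal. unfold s0. field. lra. }
        lra. }
  assert (haT : a < T) by lra.
  assert (ham : 0 < a < Rmin T (lam * rho)) by (split; [lra|apply Rmin_glb_lt; lra]).
  assert (hva : / 2 <= v a).
  { apply hhalf; lra. }
  assert (hWa : W0 <= W a).
  { apply (flux_ge N p hp k v W T hflow k1 k2 (lam * rho) hk1 hk hS0); trivial.
    unfold a. lra. }
  pose proof (fast_decay_lower_bound N p hp k v W T hflow (E1 + E2) W0 a s ha has hsT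
    ltac:(lra) hW0) as hlow.
  assert (hineq : Rpower s m * (p * (E1 + E2) / ((N - p) * W0)) <= c).
  { apply Rle_trans with (Rpower (lam * M) m * (p * (E1 + E2) / ((N - p) * W0))).
    - apply Rmult_le_compat_r; [apply Rlt_le; pos|]. apply Rle_Rpower_l; lra.
    - replace (Rpower (lam * M) m * (p * (E1 + E2) / ((N - p) * W0)))
        with (F * (Rpower lam m * E1) + F * (Rpower lam m * E2)).
      2:{ rewrite <- (Rpower_mult_distr lam M) by lra. unfold F. field. lra. }
      replace (Rpower lam m * E1) with (D1 * Rpower lam (m - l'))
        by (unfold D1, E1, s0; rpower).
      replace (Rpower lam m * E2) with (D2 * Rpower lam (m - N / (p - 1)))
        by (unfold D2, E2, s0; rpower).
      apply (Rmult_lt_compat_l (F * D1)) in hX1; [|pos].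
      apply (Rmult_lt_compat_l (F * D2)) in hX2; [|pos].
      replace (F * D1 * (c / 2 / F / D1)) with (c / 2) in hX1 by (field; lra).
      replace (F * D2 * (c / 2 / F / D2)) with (c / 2) in hX2 by (field; lra).
      lra. }
  assert (hmain : Rpower a m * v a <= Rpower s m * v s + c).
  { eapply Rle_trans; [apply hlow|lra].
    intros t ht. split; [apply hdef; lra|].
    apply (Rle_trans _ _ _ hWa).
    apply (flux_nondecreasing N p k v W T); trivial; try lra.
    intros r hr. apply hKpos. pos. }
  assert (hfin : c <= Rpower s m * v s).
  { apply (Rmult_le_compat_l (Rpower a m)) in hva; [|apply Rlt_le; pos].
    unfold c in *. lra. }
  apply (Rmult_le_compat_r (Rpower s (- m))) in hfin; [|apply Rlt_le; pos].
  replace (Rpower s m * v s * Rpower s (- m)) with (v s) in hfin; [exact hfin|].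
  rewrite Rmult_comm, <- Rmult_assoc, <- Rpower_plus.
  replace (- m + m) with 0 by ring. rewrite Rpower_O by lra. ring.
Qed.

Lemma rescaled_not_global :
  exists X, 0 < X /\ forall lam, X < lam -> forall v W,
    ~ (forall T, regular_flow N p (fun s => K (s / lam)) v W T).
Proof.
  destruct (rescaled_lower_bound rho k2 hrho) as [c [X [hc [hX h]]]].
  { intros r hr. apply (hKnear r hr). }
  pose proof (half_life_pos N p k2) as hhl.
  set (a := half_life N p k2 / 2) in *. assert (ha : 0 < a) by (unfold a; lra).
  assert (hk2 : 0 < k2) by (specialize (hKnear (rho / 2) ltac:(lra)); lra).
  (* In the logarithmic bound lambda^(-l) meets (lambda rho)^(l-N/(p-1)), so it has the same power
     lambda^(-N/(p-1)) as the potential at [s0], and only the logarithm decides. *)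
  set (D3 := b1 * Rpower c q * Rpower rho (l - N / (p - 1))).
  assert (hD3 : 0 < D3) by (unfold D3; pos).
  set (D4 := k2 * (Rpower (decay_constant N p k1) q * Rpower (rho / 2) (- (N / (p - 1))))).
  (* Beyond this threshold D3 ln(s0/a) > D4, with s0 = lambda rho / 2. *)
  exists (Rmax X (2 * a / rho * exp (D4 / D3))).
  split; [eapply Rlt_le_trans; [exact hX|apply Rmax_l]|].
  intros lam hlam v W hflow.
  assert (hlam1 : X < lam) by (eapply Rle_lt_trans; [|exact hlam]; apply Rmax_l).
  assert (hlam2 : 2 * a / rho * exp (D4 / D3) < lam)
    by (eapply Rle_lt_trans; [|exact hlam]; apply Rmax_r).
  assert (hlam0 : 0 < lam) by lra.
  destruct (h lam hlam1) as [hS hlow]. clear h.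
  set (k := fun s => K (s / lam)) in *.
  pose proof (fun s => rescaled_bounds lam s hlam0) as hk.
  change (forall s, 0 < s < lam * rho -> k1 <= k s <= k2) in hk.
  pose proof (fun s => rescaled_derive_nonneg lam s hlam0) as hdk.
  change (forall s, 0 < s < lam * rho ->
    is_derive k s (K' (s / lam) / lam) /\ 0 <= K' (s / lam) / lam) in hdk.
  assert (hS0 : 0 < lam * rho) by lra.
  set (s0 := lam * rho / 2).
  assert (hs0 : 0 < s0) by (unfold s0; lra).
  assert (has0 : a < s0) by (unfold s0; lra).
  set (T := lam * rho). destruct (hlow v W T (hflow T)) as [_ hlow']. fold T in hlow'. clear hlow.
  assert (hmin : s0 < Rmin T (lam * rho)) by (apply Rmin_glb_lt; unfold T, s0; lra).
  pose proof (pohozaev_ge_log N p hp k v W T (hflow T) k1 k2 (lam * rho) hk1 hk hS0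
    (fun t => K' (t / lam) / lam) hdk (b1 * Rpower lam (- l)) c l a s0
    ltac:(pos) hc ha ltac:(lra) hmin ltac:(lra)) as hP.
  specialize (hP (fun t ht => proj1 (proj2 (rescaled_derive lam t hlam0 ht)))).
  specialize (hP (fun t ht => hlow' t (proj1 ht) (Rle_lt_trans _ _ _ (proj2 ht) hmin))).
  assert (hkin : kinetic_defect N p v W s0 <= 0).
  { apply (kinetic_defect_nonpos_of_global N p k); trivial.
    intros t ht. apply hKpos. pos. }
  pose proof (potential_le_fast N p hp k v W T (hflow T) k1 k2 (lam * rho) hk1 hk hS0
    (fun t => K' (t / lam) / lam) hdk s0 (conj hs0 hmin)) as hpot.
  assert (hks : 0 < k s0 <= k2) by (specialize (hk s0 ltac:(unfold s0 in *; lra)); lra).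
  assert (hpot2 : k s0 * Rpower s0 N * Rpower (v s0) q
    <= D4 * Rpower lam (- (N / (p - 1)))).
  { rewrite Rmult_assoc. apply Rle_trans with
      (k2 * (Rpower (decay_constant N p k1) q * Rpower s0 (- (N / (p - 1))))).
    - apply Rmult_le_compat; try lra. apply Rlt_le; pos.
    - right. unfold D4, s0. pose proof (decay_constant_pos N p k1). rpower. }
  assert (hcoef : 0 < (N - p) / (N * p)) by pos.
  unfold pohozaev in hP.
  assert (hP2 : (N - p) / (N * p) * (D3 * Rpower lam (- (N / (p - 1))) * (ln s0 - ln a))
    <= (N - p) / (N * p) * (D4 * Rpower lam (- (N / (p - 1))))).
  { apply Rle_trans with ((N - p) / (N * p) * (k s0 * Rpower s0 N * Rpower (v s0) q)).
    - eapply Rle_trans; [eapply Rle_trans; [|exact hP]|lra]. right.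
      replace (D3 * Rpower lam (- (N / (p - 1)))) with
        (b1 * Rpower lam (- l) * Rpower c q * Rpower (lam * rho) (l - N / (p - 1)))
        by (unfold D3; rpower).
      ring.
    - apply Rmult_le_compat_l; lra. }
  apply Rmult_le_reg_l in hP2; [|exact hcoef].
  replace (D3 * Rpower lam (- (N / (p - 1))) * (ln s0 - ln a))
    with (Rpower lam (- (N / (p - 1))) * (D3 * (ln s0 - ln a))) in hP2 by ring.
  rewrite (Rmult_comm D4) in hP2.
  apply Rmult_le_reg_l in hP2; [|apply Rpower_pos].
  assert (hln : ln (2 * a / rho * exp (D4 / D3)) < ln lam)
    by (apply ln_increasing; trivial; pose proof (exp_pos (D4 / D3)); pos).
  rewrite ln_mult, ln_exp, !ln_div, ln_mult in hln by (try apply exp_pos; pos).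
  unfold s0 in hP2. rewrite ln_div, ln_mult in hP2 by pos.
  assert (hgap : D3 * (D4 / D3) < D3 * (ln lam + ln rho - ln 2 - ln a))
    by (apply Rmult_lt_compat_l; lra).
  replace (D3 * (D4 / D3)) with D4 in hgap by (field; lra).
  lra.
Qed.

End Rescaled.

(** * Rescaling a regular solution *)

Lemma signed_power_of_pos (m x : R) : 0 < x -> signed_power m x = Rpower x (m - 1).
Proof.
  intros hx. unfold signed_power. rewrite Rabs_pos_eq by lra.
  rewrite (Rpower_pred x (m - 1)) by exact hx. f_equal. f_equal. ring.
Qed.

Lemma signed_power_opp (m x : R) : signed_power m (- x) = - signed_power m x.
Proof. unfold signed_power. rewrite Rabs_Ropp. ring. Qed.

Lemma signed_power_pos_inv (m x : R) : 1 < m -> 0 < signed_power m x ->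
  x = Rpower (signed_power m x) (/ (m - 1)).
Proof.
  intros hm h.
  assert (hx : 0 < x).
  { apply (Rmult_lt_reg_r (Rpower (Rabs x) (m - 2))); [apply Rpower_pos|].
    rewrite Rmult_0_l. exact h. }
  rewrite signed_power_of_pos, Rpower_mult by exact hx.
  replace ((m - 1) * / (m - 1)) with 1 by (field; lra).
  now rewrite Rpower_1.
Qed.

(** Since f + (c/m) r^(-m) is nondecreasing, f(r) tends to minus infinity at 0. *)
Lemma unbounded_below_of_steep (f : R -> R) (m c b B : R) :
  0 < m -> 0 < c -> 0 < b ->
  (forall r, 0 < r <= b -> exists l, is_derive f r l /\ c * Rpower r (- m - 1) <= l) ->
  ~ (forall r, 0 < r <= b -> B <= f r).
Proof.
  intros hm hc hb hf hB.
  (* [X] is the value of r^(-m) at which the upper bound for f(r) equals [B]; the maximum in [Y]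
     keeps r <= b. *)
  set (X := (f b + c / m * Rpower b (- m) - B) / (c / m)).
  set (Y := Rmax (Rpower b (- m)) (X + 1)).
  assert (hY1 : Rpower b (- m) <= Y) by apply Rmax_l.
  assert (hY2 : X + 1 <= Y) by apply Rmax_r.
  pose proof (Rpower_pos b (- m)) as hbm.
  set (r := Rpower Y (- / m)).
  assert (him : 0 < / m) by pos.
  assert (hr : 0 < r <= b).
  { split; [apply Rpower_pos|].
    apply Rle_trans with (Rpower (Rpower b (- m)) (- / m)).
    - apply Rpower_neg_le; lra.
    - rewrite Rpower_mult. replace (- m * - / m) with 1 by (field; lra).
      rewrite Rpower_1; lra. }
  assert (hrm : Rpower r (- m) = Y).
  { unfold r. rewrite Rpower_mult. replace (- / m * - m) with 1 by (field; lra).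
    apply Rpower_1. lra. }
  assert (hmono : f r + c / m * Rpower r (- m) <= f b + c / m * Rpower b (- m)).
  { apply (nondecreasing_of_derive (fun t => f t + c / m * Rpower t (- m))); [lra|].
    intros t ht. destruct (hf t ltac:(lra)) as [l [dl hl]].
    eexists; split; [derive_rules; lra|].
    change one with 1. change zero with 0.
    replace (Rpower t (- m - 1)) with (Rpower t (- m) / t) in hl.
    2:{ rewrite (Rpower_pred t (- m)) by lra. field. lra. }
    match goal with |- 0 <= ?x => replace x with (l - c * (Rpower t (- m) / t)) end; [lra|].
    set (Z := Rpower t (- m)). field. lra. }
  rewrite hrm in hmono. specialize (hB r hr).
  assert (hcm : 0 < c / m) by pos.
  assert (hX : c / m * X = f b + c / m * Rpower b (- m) - B) by (unfold X; field; lra).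
  assert (c / m * (X + 1) <= c / m * Y) by (apply Rmult_le_compat_l; lra).
  lra.
Qed.

Section RegularSolution.

Context (n : nat) (p : R) (K w : R -> R) (d : R).
Context (hn : (0 < n)%nat) (hp : 1 < p < INR n) (hd : 0 < d).
Context (hKpos : forall r, 0 < r -> 0 < K r).
Context (hw : regular_solution n p K d w).

Local Notation N := (INR n).
Local Notation q := (N * p / (N - p)).

Definition flux (r : R) : R := - (r ^ (n - 1) * signed_power p (Derive w r)).

Lemma pow_pred_Rpower (r : R) : 0 < r -> r ^ (n - 1) = Rpower r (N - 1).
Proof.
  intros hr. rewrite <- Rpower_pow by exact hr. f_equal.
  rewrite minus_INR by exact hn. reflexivity.
Qed.

Lemma is_derive_flux (r : R) : 0 < r ->
  is_derive flux r (Rpower r (N - 1) * K r * signed_power q (w r)).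
Proof.
  intros hr. destruct (proj1 hw r hr) as [_ h].
  eapply is_derive_R_eq; [exact (is_derive_opp _ _ _ h)|].
  rewrite pow_pred_Rpower by exact hr. unfold opp; simpl. unfold critical_exponent. ring.
Qed.

Lemma signed_power_derive (r : R) : 0 < r ->
  signed_power p (- Derive w r) = flux r * Rpower r (1 - N).
Proof.
  intros hr. rewrite signed_power_opp. unfold flux. rewrite pow_pred_Rpower by exact hr.
  replace (1 - N) with (- (N - 1)) by ring. rewrite Rpower_Ropp.
  pose proof (Rpower_pos r (N - 1)). field. lra.
Qed.

Lemma derive_of_flux_pos (r : R) : 0 < r -> 0 < flux r ->
  Derive w r = - speed N p r (flux r).
Proof.
  intros hr hf.
  pose proof (signed_power_derive r hr) as h.
  assert (h0 : 0 < signed_power p (- Derive w r)) by (rewrite h; pos).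
  apply signed_power_pos_inv in h0; [|lra]. rewrite h in h0.
  unfold speed. lra.
Qed.

Lemma derive_of_flux_neg (r : R) : 0 < r -> flux r < 0 ->
  Derive w r = speed N p r (- flux r).
Proof.
  intros hr hf.
  pose proof (signed_power_derive r hr) as h.
  rewrite signed_power_opp in h.
  assert (h1 : signed_power p (Derive w r) = - flux r * Rpower r (1 - N)) by lra.
  assert (h0 : 0 < signed_power p (Derive w r))
    by (rewrite h1; apply Rmult_lt_0_compat; [lra|apply Rpower_pos]).
  apply signed_power_pos_inv in h0; [|lra]. now rewrite h1 in h0.
Qed.

Lemma is_derive_solution (r : R) : 0 < r -> is_derive w r (Derive w r).
Proof. intros hr. apply Derive_correct. apply (proj1 hw r hr). Qed.

Lemma solution_near_0 (eps : R) : 0 < eps ->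
  exists delta, 0 < delta /\ forall r, 0 < r < delta -> Rabs (w r - d) < eps.
Proof.
  intros heps. destruct hw as [_ hlim].
  destruct (proj1 (filterlim_locally w d) hlim (mkposreal eps heps)) as [delta h].
  exists delta. split; [apply cond_pos|]. intros r hr.
  apply (h r); [|lra].
  change (Rabs (r - 0) < delta). rewrite Rminus_0_r, Rabs_pos_eq; lra.
Qed.

Lemma solution_pos (T : R) : (forall r, 0 < r < T -> w r <> 0) ->
  forall r, 0 < r < T -> 0 < w r.
Proof.
  intros hne r hr. apply Rnot_le_lt. intros hle.
  assert (hlt : w r < 0) by (specialize (hne r hr); lra).
  destruct (solution_near_0 d hd) as [delta [hdelta h]].
  set (x := Rmin (r / 2) (delta / 2)).
  assert (hx : 0 < x) by (apply Rmin_glb_lt; lra).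
  assert (hxr : x <= r / 2) by apply Rmin_l.
  assert (hxd : x <= delta / 2) by apply Rmin_r.
  specialize (h x ltac:(lra)). apply Rabs_def2 in h.
  destruct (IVT_interv (fun t => - w t) x r) as [z [hz hz0]]; try lra.
  - intros a ha. apply continuity_pt_opp. apply continuity_pt_filterlim.
    apply (ex_derive_continuous (V := R_NormedModule)).
    eexists. apply is_derive_solution. lra.
  - apply (hne z); lra.
Qed.

Lemma flux_monotone (T x y : R) : (forall r, 0 < r < T -> 0 < w r) ->
  0 < x -> x <= y -> y < T -> flux x <= flux y.
Proof.
  intros hpos hx hxy hy. apply nondecreasing_of_derive; [exact hxy|].
  intros t ht. eexists; split; [apply is_derive_flux; lra|].
  rewrite signed_power_of_pos by (apply hpos; lra).
  specialize (hKpos t ltac:(lra)). apply Rlt_le; pos.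
Qed.

(* A nonzero limit of the flux at 0 would force |w'| >= c r^(-(N-1)/(p-1)), which is
   not integrable at 0, whereas w is bounded there. *)
Lemma flux_vanishes_at_0 (T : R) : 0 < T -> (forall r, 0 < r < T -> 0 < w r) ->
  (forall r, 0 < r < T -> 0 <= flux r) /\
  forall eps, 0 < eps -> exists delta, 0 < delta /\
    forall r, 0 < r < delta -> flux r < eps.
Proof.
  intros hT hpos.
  set (m := (N - p) / (p - 1)). assert (hm : 0 < m) by (unfold m; pos).
  assert (hspeed : forall a r z, 0 < a -> a <= z -> 0 < r ->
    Rpower a (/ (p - 1)) * Rpower r (- m - 1) <= speed N p r z).
  { intros a r z ha hz hr.
    replace (Rpower a (/ (p - 1)) * Rpower r (- m - 1))
      with (Rpower (a * Rpower r (1 - N)) (/ (p - 1))) by (unfold m; rpower).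
    apply Rle_Rpower_l; [apply Rlt_le; pos|]. split; [pos|].
    apply Rmult_le_compat_r; [apply Rlt_le; pos|exact hz]. }
  split.
  (* By monotonicity a negative flux at [b] stays at most [flux b] towards 0, so w would become
     negative there. *)
  - intros b hb. apply Rnot_lt_le. intros hneg.
    apply (unbounded_below_of_steep w m (Rpower (- flux b) (/ (p - 1))) b 0); try lra.
    + apply Rpower_pos.
    + intros r hr.
      pose proof (flux_monotone T r b hpos ltac:(lra) ltac:(lra) ltac:(lra)) as hmono.
      exists (Derive w r). split; [apply is_derive_solution; lra|].
      rewrite derive_of_flux_neg by lra. apply hspeed; lra.
    + intros r hr. apply Rlt_le, hpos. lra.
  - intros eps heps.
    destruct (classic (exists r, 0 < r < T /\ flux r < eps)) as [[b [hb hbe]]|hno].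
    + exists b. split; [lra|]. intros r hr.
      pose proof (flux_monotone T r b hpos ltac:(lra) ltac:(lra) ltac:(lra)). lra.
    + exfalso.
      destruct (solution_near_0 d hd) as [delta [hdelta h]].
      set (b := Rmin (T / 2) (delta / 2)).
      assert (hb : 0 < b) by (apply Rmin_glb_lt; lra).
      assert (hbT : b <= T / 2) by apply Rmin_l.
      assert (hbd : b <= delta / 2) by apply Rmin_r.
      apply (unbounded_below_of_steep (fun r => - w r) m (Rpower eps (/ (p - 1))) b
               (- (2 * d))); trivial.
      * apply Rpower_pos.
      * intros r hr.
        assert (hr1 : eps <= flux r).
        { apply Rnot_lt_le. intros hlt. apply hno. exists r. split; [lra|exact hlt]. }
        exists (- Derive w r). split.
        { exact (is_derive_opp _ _ _ (is_derive_solution r ltac:(lra))). }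
        rewrite derive_of_flux_pos by lra. rewrite Ropp_involutive. apply hspeed; lra.
      * intros r hr. specialize (h r ltac:(lra)). apply Rabs_def2 in h. lra.
Qed.

Lemma flux_pos (T r : R) : (forall s, 0 < s < T -> 0 < w s) -> 0 < r < T -> 0 < flux r.
Proof.
  intros hpos hr.
  destruct (flux_vanishes_at_0 T ltac:(lra) hpos) as [h _].
  apply Rle_lt_trans with (flux (r / 2)); [apply h; lra|].
  apply (incr_function flux 0 T
    (fun t => Rpower t (N - 1) * K t * signed_power q (w t))); simpl; try lra.
  - intros t h0 hT. apply is_derive_flux. exact h0.
  - intros t h0 hT. rewrite signed_power_of_pos by (apply hpos; lra).
    specialize (hKpos t h0). pos.
Qed.

(** The equation is preserved because lam^p = d^(q-p). The flux acquires the factor lam^(N-p)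
    d^(1-p), which equals d. *)
Lemma rescaled_regular_flow (T : R) : (forall r, 0 < r < T -> w r <> 0) -> 0 < T ->
  let lam := Rpower d (p / (N - p)) in
  regular_flow N p (fun s => K (s / lam)) (fun s => w (s / lam) / d)
    (fun s => d * flux (s / lam)) (lam * T).
Proof.
  intros hne hT lam. pose proof (solution_pos T hne) as hpos.
  assert (hlam : 0 < lam) by apply Rpower_pos.
  assert (hsmall : forall s X, 0 < s < lam * X -> 0 < s / lam < X).
  { intros s X hs. split; [pos|]. apply (Rmult_lt_reg_r lam); [exact hlam|].
    replace (s / lam * lam) with s by (field; lra). lra. }
  split.
  - intros s hs. pose proof (hsmall s T hs) as hr.
    pose proof (hpos _ hr) as hwr. pose proof (flux_pos T _ hpos hr) as hfr.
    assert (dscale : is_derive (fun t => t / lam) s (/ lam)).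
    { eapply is_derive_R_eq.
      - apply (is_derive_R_mult (fun t => t) (fun _ => / lam)); derive_rules.
      - change one with 1. change zero with 0. ring. }
    split; [pos|]. split; [pos|]. split.
    + pose proof (is_derive_comp w (fun t => t / lam) s _ _
        (is_derive_solution _ (proj1 hr)) dscale) as dcomp.
      rewrite derive_of_flux_pos in dcomp by lra.
      eapply is_derive_R_eq.
      * apply (is_derive_R_mult (fun t => w (t / lam)) (fun _ => / d)); [exact dcomp|derive_rules].
      * change zero with 0. unfold scal; simpl; unfold mult; simpl.
        replace (speed N p s (d * flux (s / lam)))
          with (/ lam * speed N p (s / lam) (flux (s / lam)) * / d).
        { ring. }
        unfold speed. set (Z := flux (s / lam)) in *. unfold lam in *. rpower.
    + pose proof (is_derive_comp flux (fun t => t / lam) s _ _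
        (is_derive_flux _ (proj1 hr)) dscale) as dcomp.
      eapply is_derive_R_eq.
      * apply (is_derive_R_mult (fun _ => d) (fun t => flux (t / lam))); [derive_rules|exact dcomp].
      * change zero with 0. unfold scal; simpl; unfold mult; simpl.
        rewrite signed_power_of_pos by exact hwr.
        set (Z := w (s / lam)) in *. set (Y := K (s / lam)).
        assert (he : Rpower s (N - 1) * Rpower (Z / d) (q - 1)
                     = d * / lam * Rpower (s / lam) (N - 1) * Rpower Z (q - 1))
          by (unfold lam; rpower).
        replace (Rpower s (N - 1) * Y * Rpower (Z / d) (q - 1))
          with (Y * (Rpower s (N - 1) * Rpower (Z / d) (q - 1))) by ring.
        rewrite he. ring.
  - intros eps heps.
    destruct (solution_near_0 (eps * d) ltac:(pos)) as [d1 [hd1 h1]].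
    destruct (proj2 (flux_vanishes_at_0 T hT hpos) (eps / d) ltac:(pos)) as [d2 [hd2 h2]].
    exists (lam * Rmin d1 d2). split; [apply Rmult_lt_0_compat; [lra|now apply Rmin_glb_lt]|].
    intros s hs. apply hsmall in hs.
    pose proof (Rmin_l d1 d2). pose proof (Rmin_r d1 d2).
    specialize (h1 (s / lam) ltac:(lra)). specialize (h2 (s / lam) ltac:(lra)).
    split.
    + replace (w (s / lam) / d - 1) with ((w (s / lam) - d) / d) by (field; lra).
      unfold Rdiv at 1. rewrite Rabs_mult, (Rabs_pos_eq (/ d)) by (apply Rlt_le; pos).
      apply (Rmult_lt_compat_r (/ d)) in h1; [|pos].
      replace (eps * d * / d) with eps in h1 by (field; lra). exact h1.
    + apply (Rmult_lt_compat_l d) in h2; [|lra].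
      replace (d * (eps / d)) with eps in h2 by (field; lra). exact h2.
Qed.

End RegularSolution.

(** * Behaviour of the coefficient, and the limit *)

Lemma positive_C1_half_line_derive (K : R -> R) : positive_C1_half_line K ->
  exists K' : R -> R, forall r, 0 < r -> is_derive K r (K' r).
Proof.
  intros [_ [K' h]]. exists K'. intros r hr.
  destruct (h r ltac:(lra)) as [hD _].
  apply is_derive_Reals. intros eps heps.
  destruct (hD eps heps) as [delta [hdelta hlim]].
  (* Increments shorter than r stay in the half-line, so the constrained limit is two-sided. *)
  assert (hmin : 0 < Rmin delta r) by (apply Rmin_glb_lt; lra).
  exists (mkposreal _ hmin). simpl. intros x hx0 hx.
  pose proof (Rmin_l delta r). pose proof (Rmin_r delta r).
  assert (hx' : Rabs x < r) by lra. apply Rabs_def2 in hx'.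
  specialize (hlim (r + x)). simpl in hlim. unfold Rdist in hlim.
  replace (r + x - r) with x in hlim by ring.
  apply hlim. split; [|lra]. split; [lra|lra].
Qed.

Lemma coefficient_near_0 (K K' h : R -> R) (A B l : R) :
  0 < A -> 0 < B -> 0 < l ->
  (forall r, 0 < r -> is_derive K r (K' r)) ->
  (forall r, 0 < r -> K r = A + B * Rpower r l + h r) ->
  filterlim (fun r => (Rabs (h r) + r * Rabs (Derive h r)) / Rpower r l)
    (at_right 0) (locally 0) ->
  exists rho, 0 < rho /\ forall r, 0 < r < rho ->
    A / 2 <= K r <= 2 * A /\
    B * l / 2 * Rpower r (l - 1) <= K' r <= 2 * B * l * Rpower r (l - 1).
Proof.
  intros hA hB hl dK hK hh.
  (* Then |h'| is at most half of the leading term B l r^(l-1) of K'; [x] below ensures (B + eps)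
     r^l <= A / 2. *)
  set (eps := B * l / 2). assert (heps : 0 < eps) by (unfold eps; pos).
  destruct (proj1 (filterlim_locally _ 0) hh (mkposreal eps heps)) as [delta hdelta].
  set (x := A / 2 / (B + eps)).
  assert (hBe : 0 < B + eps) by lra.
  assert (hx : 0 < x) by (unfold x; pos).
  exists (Rmin delta (Rpower x (/ l))). split.
  { apply Rmin_glb_lt; [apply cond_pos|apply Rpower_pos]. }
  intros r hr.
  pose proof (Rmin_l delta (Rpower x (/ l))). pose proof (Rmin_r delta (Rpower x (/ l))).
  assert (hrl : Rpower r l <= x).
  { replace x with (Rpower (Rpower x (/ l)) l).
    - apply Rle_Rpower_l; lra.
    - rewrite Rpower_mult. replace (/ l * l) with 1 by (field; lra). now apply Rpower_1. }
  pose proof (Rpower_pos r l) as hrl0.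
  assert (hball : (Rabs (h r) + r * Rabs (Derive h r)) / Rpower r l < eps).
  { specialize (hdelta r). change (Rabs (r - 0) < delta -> 0 < r ->
      Rabs ((Rabs (h r) + r * Rabs (Derive h r)) / Rpower r l - 0) < eps) in hdelta.
    rewrite !Rminus_0_r, Rabs_pos_eq in hdelta by lra.
    specialize (hdelta ltac:(lra) ltac:(lra)). apply Rabs_def2 in hdelta. lra. }
  apply (Rmult_lt_compat_r (Rpower r l)) in hball; [|exact hrl0].
  replace ((Rabs (h r) + r * Rabs (Derive h r)) / Rpower r l * Rpower r l)
    with (Rabs (h r) + r * Rabs (Derive h r)) in hball by (field; lra).
  pose proof (Rabs_pos (h r)) as hh0. pose proof (Rabs_pos (Derive h r)) as hh1.
  assert (hh2 : 0 <= r * Rabs (Derive h r)) by (apply Rmult_le_pos; lra).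
  split.
  - assert (hAx : (B + eps) * Rpower r l <= A / 2).
    { replace (A / 2) with ((B + eps) * x) by (unfold x; field; lra).
      apply Rmult_le_compat_l; lra. }
    assert (habs : Rabs (h r) <= eps * Rpower r l) by lra.
    apply Rabs_le_between in habs.
    assert (0 < B * Rpower r l) by pos. rewrite (hK r) by lra. lra.
  (* [Derive] is total, so its value must be justified: near r, [h] agrees with the differentiable
     function K - A - B r^l. *)
  - assert (dh : Derive h r = K' r - B * (l * Rpower r l / r)).
    { apply is_derive_unique.
      apply (is_derive_ext_loc (fun t => K t - (A + B * Rpower t l))).
      - exists (mkposreal r (proj1 hr)). intros t ht. simpl in ht.
        change (Rabs (t - r) < r) in ht. apply Rabs_def2 in ht.
        change (K t - (A + B * Rpower t l) = h t). rewrite (hK t) by lra. ring.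
      - pose proof (dK r (proj1 hr)) as dKr.
        eapply is_derive_R_eq; [derive_rules; lra|].
        change one with 1. change zero with 0. field. lra. }
    assert (hpred : Rpower r l / r = Rpower r (l - 1)).
    { rewrite (Rpower_pred r l) by lra. field. lra. }
    assert (hd : Rabs (Derive h r) <= eps * Rpower r (l - 1)).
    { rewrite <- hpred. apply (Rmult_le_reg_l r); [lra|].
      replace (r * (eps * (Rpower r l / r))) with (eps * Rpower r l) by (field; lra). lra. }
    apply Rabs_le_between in hd. rewrite dh in hd.
    replace (l * Rpower r l / r) with (l * Rpower r (l - 1)) in hd
      by (rewrite <- hpred; field; lra).
    pose proof (Rpower_pos r (l - 1)).
    assert (0 < B * l * Rpower r (l - 1)) by pos.
    unfold eps in *. lra.
Qed.

Lemma coefficient_bounded (K : R -> R) (rho k M : R) : 0 < rho ->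
  (forall r, 0 < r -> ex_derive K r) -> (forall r, 0 < r < rho -> K r <= k) ->
  exists kM, forall r, 0 < r < M -> K r <= kM.
Proof.
  intros hrho dK hk.
  destruct (Rle_dec M (rho / 2)) as [hM|hM].
  { exists k. intros r hr. apply hk. lra. }
  apply Rnot_le_lt in hM.
  destruct (continuity_ab_maj K (rho / 2) M ltac:(lra)) as [x [hx _]].
  { intros c hc. apply continuity_pt_filterlim.
    apply (ex_derive_continuous (V := R_NormedModule)). apply dK. lra. }
  exists (Rmax k (K x)). intros r hr. destruct (Rlt_dec r rho) as [h|h].
  - apply Rle_trans with k; [apply hk; lra|apply Rmax_l].
  - apply Rle_trans with (K x); [apply hx; lra|apply Rmax_r].
Qed.

(* [u d r] is u(r;d), and [Rz d] is R(d) for d in J = [crossing_set u]; [Rz] is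
   arbitrary outside J, so the conclusion includes that R(d) is defined for all
   large d.  The expansion of K is stated for r > 0 because
   [Rpower 0 l = 1]; at r = 0 it would only read h(0) = K(0) - A. *)
Theorem proposition46 (n : nat) (p : R) (K : R -> R)
    (u : R -> R -> R) (Rz : R -> R) (A B l : R) (h : R -> R)
    (hn : (0 < n)%nat)
    (hp : 1 < p < INR n)
    (hp2 : 2 * INR n / (INR n + 2) <= p <= 2)
    (hK : positive_C1_half_line K)
    (hu : forall d, 0 < d -> regular_solution n p K d (u d))
    (hRz : forall d, crossing_set u d -> is_first_zero (u d) (Rz d))
    (hA : 0 < A) (hB : 0 < B)
    (hl : (INR n - p) / (p - 1) < l <= INR n / (p - 1))
    (hKexp : forall r, 0 < r -> K r = A + B * Rpower r l + h r)
    (hh : filterlim (fun r => (Rabs (h r) + r * Rabs (Derive h r)) / Rpower r l)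
            (at_right 0) (locally 0))
    (hab :
       (uniform_continuity (fun t => K (exp t)) (fun t => 0 <= t) /\
        exists Klow Kup : R,
          Kup > Klow /\ Klow > 0 /\ forall r, 0 < r -> Klow < K r < Kup)
       \/
       (exists rho1 : R, 0 < rho1 /\ forall r, rho1 <= r -> K rho1 <= K r)) :
  is_lim Rz p_infty p_infty.
Proof.
  set (N := INR n) in *.
  assert (hl0 : 0 < l).
  { apply Rlt_trans with ((N - p) / (p - 1)); [pos|lra]. }
  assert (hKpos : forall r, 0 < r -> 0 < K r)
    by (intros r hr; apply (proj1 hK); lra).
  destruct (positive_C1_half_line_derive K hK) as [K' dK].
  destruct (coefficient_near_0 K K' h A B l hA hB hl0 dK hKexp hh) as [rho [hrho hnear]].
  assert (hk1 : 0 < A / 2) by lra.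
  assert (hb1 : 0 < B * l / 2) by pos.
  assert (hb2 : 0 < 2 * B * l) by pos.
  assert (hKnear : forall r, 0 < r < rho -> A / 2 <= K r <= 2 * A)
    by (intros r hr; apply (hnear r hr)).
  assert (hKder : forall r, 0 < r < rho -> is_derive K r (K' r) /\
    B * l / 2 * Rpower r (l - 1) <= K' r <= 2 * B * l * Rpower r (l - 1))
    by (intros r hr; split; [apply dK; lra|apply (hnear r hr)]).
  apply is_lim_spec. intros M.
  set (M' := Rmax M 1).
  assert (hM' : M <= M') by apply Rmax_l.
  assert (hM'0 : 1 <= M') by apply Rmax_r.
  destruct (coefficient_bounded K rho (2 * A) M' hrho) as [kM hkM].
  { intros r hr. eexists. now apply dK. }
  { intros r hr. apply (hKnear r hr). }
  destruct (rescaled_lower_bound N p hp K K' (A / 2) (2 * A) rho (B * l / 2) (2 * B * l) l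
    hl hk1 hrho hb1 hb2 hKpos hKnear hKder M' kM ltac:(lra) hkM) as [c [X [hc [hX hlow]]]].
  destruct (rescaled_not_global N p hp K K' (A / 2) (2 * A) rho (B * l / 2) (2 * B * l) l
    hl hk1 hrho hb1 hb2 hKpos hKnear hKder) as [X' [hX' hglob]].
  exists (Rpower (Rmax X X') ((N - p) / p)). intros d hd.
  pose proof (Rpower_pos (Rmax X X') ((N - p) / p)) as hd0.
  assert (hdpos : 0 < d) by lra.
  set (lam := Rpower d (p / (N - p))).
  assert (hlam0 : 0 < lam) by apply Rpower_pos.
  assert (hlam : Rmax X X' < lam).
  { replace (Rmax X X') with (Rpower (Rpower (Rmax X X') ((N - p) / p)) (p / (N - p))).
    - apply Rlt_Rpower_l; [pos|lra].
    - rewrite Rpower_mult. replace ((N - p) / p * (p / (N - p))) with 1 by (field; lra).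
      apply Rpower_1. eapply Rlt_le_trans; [exact hX|apply Rmax_l]. }
  assert (hlX : X < lam) by (eapply Rle_lt_trans; [apply Rmax_l|exact hlam]).
  assert (hlX' : X' < lam) by (eapply Rle_lt_trans; [apply Rmax_r|exact hlam]).
  pose proof (fun T => rescaled_regular_flow n p K (u d) d hn hp hdpos hKpos (hu d hdpos) T)
    as hflow.
  change (Rpower d (p / (INR n - p))) with lam in hflow.
  destruct (classic (exists r, 0 < r /\ u d r = 0)) as [hcross|hno].
  - destruct (hRz d (conj hdpos hcross)) as [hR [hR0 hRfirst]].
    set (T := lam * Rz d).
    assert (hT : 0 < T) by (unfold T; pos).
    specialize (hflow (Rz d) hRfirst hR).
    (* If R(d) <= M, the lower bound holds on all of (0,T), where T = lam R(d) is the rescaled zero,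
       and v cannot tend to 0 at T. *)
    apply Rnot_le_lt. intros hle.
    destruct (hlow lam hlX) as [_ hlow'].
    destruct (hlow' _ _ _ hflow) as [hhalf htail].
    assert (hTM : T <= lam * M') by (apply Rmult_le_compat_l; lra).
    assert (hcT : 0 < c * Rpower T (- ((N - p) / (p - 1)))) by pos.
    (* The two entries bound v on the initial stretch and, since s^(-m) decreases, on the rest of
       (0,T). *)
    set (c0 := Rmin (/ 2) (c * Rpower T (- ((N - p) / (p - 1))))).
    assert (hc0 : 0 < c0) by (apply Rmin_glb_lt; lra).
    assert (hlower : forall r, 0 < r < Rz d -> c0 * d <= u d r).
    { intros r hr.
      assert (hs : 0 < lam * r < T) by (split; [pos|apply Rmult_lt_compat_l; lra]).
      assert (h1 : c0 <= u d (lam * r / lam) / d).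
      { destruct (Rle_dec (lam * r) (half_life N p (2 * A) / 2)) as [hsmall|hbig].
        - eapply Rle_trans; [apply Rmin_l|]. now apply hhalf.
        - eapply Rle_trans; [apply Rmin_r|].
          eapply Rle_trans; [|apply htail; [lra|apply Rmin_glb_lt; unfold T in *; lra]].
          apply Rmult_le_compat_l; [lra|]. apply Rpower_neg_le; [|lra].
          assert (0 < (N - p) / (p - 1)) by pos. lra. }
      replace (lam * r / lam) with r in h1 by (field; lra).
      apply (Rmult_le_compat_r d) in h1; [|lra].
      replace (u d r / d * d) with (u d r) in h1 by (field; lra). exact h1. }
    assert (hcont : continuous (u d) (Rz d)).
    { apply (ex_derive_continuous (V := R_NormedModule)).
      apply (proj1 (hu d hdpos) (Rz d) hR). }
    assert (hcd : 0 < c0 * d) by pos.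
    destruct (proj1 (filterlim_locally _ _) hcont (mkposreal _ hcd)) as [delta hdelta].
    set (r := Rz d - Rmin (delta / 2) (Rz d / 2)).
    pose proof (Rmin_l (delta / 2) (Rz d / 2)). pose proof (Rmin_r (delta / 2) (Rz d / 2)).
    pose proof (cond_pos delta) as hdp.
    assert (hm0 : 0 < Rmin (delta / 2) (Rz d / 2)) by (apply Rmin_glb_lt; lra).
    specialize (hlower r ltac:(unfold r; lra)).
    assert (hball : Rabs (u d r - u d (Rz d)) < c0 * d).
    { apply (hdelta r). change (Rabs (r - Rz d) < delta).
      unfold r. apply Rabs_def1; lra. }
    rewrite hR0 in hball. apply Rabs_def2 in hball. lra.
  (* Without a zero the rescaled solution is a regular flow for every T, so d lies in J; [Rmax 1]
     below covers nonpositive T. *)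
  - exfalso. refine (hglob lam hlX' _ _ _).
    intros T.
    assert (hne : forall r, 0 < r -> u d r <> 0)
      by (intros r hr h0; apply hno; exists r; now split).
    specialize (hflow (Rmax 1 (T / lam)) (fun r hr => hne r (proj1 hr))).
    destruct (hflow ltac:(eapply Rlt_le_trans; [apply Rlt_0_1|apply Rmax_l])) as [h1 h2].
    split; [|exact h2]. intros s hs. apply h1. split; [lra|].
    apply Rlt_le_trans with T; [lra|].
    apply Rle_trans with (lam * (T / lam)); [right; field; lra|].
    apply Rmult_le_compat_l; [lra|apply Rmax_r].
Qed.
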